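(* Let $E$ be a Borel space and $Q$ a semi-Markov kernel on $\mathbb{R}_+\times E$ given $E$ satisfying the regularity condition: there exist $\delta>0$ and $\epsilon>0$ such that $Q(\delta,E\mid x)\le 1-\epsilon$ for all $x\in E$. Let $c,g:E\to[0,\infty)$ be measurable, fix $T\in\mathbb{R}_+$, and let $V^*$ be the optimal stopping value function described in the context. Define $V^*_0\equiv 0$ on $[0,T]\times E$ and $V^*_{n+1}=\mathbb{G}V^*_n$ for $n\ge 0$. Then $V^*(s,x)=\lim_{n\to\infty}V^*_n(s,x)$ for all $(s,x)\in[0,T]\times E$, and moreover $V^*=\mathbb{G}V^*$ on $[0,T]\times E$.
   Context: Semi-Markov kernel: for each $B\in\mathcal{B}(E)$ and $x\in E$, $t\mapsto Q(t,B\mid x)$ is nondecreasing, right-continuous on $\mathbb{R}_+$ with $Q(0,B\mid x)=0$; for each $t$, $Q(t,\cdot\mid\cdot)$ is a substochastic kernel on $E$; $\lim_{t\to\infty}Q(t,\cdot\mid\cdot)$ is a stochastic kernel on $E$. Let $\Omega=\{(x_0,t_1,x_1,t_2,x_2,\dots): x_0\in E,\ (t_n,x_n)\in\mathbb{R}_+\times E\}$ with its product Borel $\sigma$-algebra; $X_n(\omega)=x_n$, $T_0=0$, $T_{n+1}(\omega)=t_{n+1}$, $S_n=\sum_{k=0}^n T_k$, $Y_n=(X_0,T_1,X_1,\dots,T_n,X_n)$, $\mathcal{F}_n=\sigma(T_0,X_0,\dots,T_n,X_n)$. For $x\in E$, $\mathbb{P}_x$ is the unique probability measure on $\Omega$ with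 $\mathbb{P}_x(T_0=0,X_0=x)=1$ and $\mathbb{P}_x(T_{n+1}\le t,X_{n+1}\in B\mid Y_n)=Q(t,B\mid X_n)$; $\mathbb{E}_x$ is its expectation. The process $X(t)=X_n$ for $S_n\le t<S_{n+1}$. A stopping time is a map $\tau:\Omega\to\mathbb{N}\cup\{+\infty\}$ ($\mathbb{N}=\{0,1,2,\dots\}$) with $\{\tau=n\}\in\mathcal{F}_n$ for all $n\in\mathbb{N}$; $\Gamma$ is the set of stopping times. For a horizon $s\in\mathbb{R}_+$ and $\tau\in\Gamma$, $R^s_\tau=\int_0^{S_\tau}c(X(t))\,dt+g(X(S_\tau))$ if $S_\tau<s$ and $R^s_\tau=\int_0^s c(X(t))\,dt$ if $S_\tau\ge s$ (with $S_\tau=\lim_n S_n$ on $\{\tau=\infty\}$); $V^\tau(s,x)=\mathbb{E}_x[R^s_\tau]$ and $V^*(s,x)=\inf_{\tau\in\Gamma}V^\tau(s,x)$. For a Borel function $u:[0,T]\times E\to[0,\infty]$, $\mathbb{G}u(s,x)=\min\Big\{c(x)\int_0^s(1-Q(t,E\mid x))\,dt+\int_E\int_{[0,s]}u(s-t,y)\,Q(dt,dy\mid x),\ g(x)\Big\}$. *)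

(* Defs.v *)
From HB Require Import structures.
From mathcomp Require Import all_boot all_order all_algebra.
From mathcomp Require Import all_classical all_reals all_analysis.
Set Implicit Arguments. Unset Strict Implicit. Unset Printing Implicit Defensive.
Import Order.TTheory GRing.Theory Num.Theory.
Import numFieldNormedType.Exports.
Local Open Scope classical_set_scope.
Local Open Scope ring_scope.

Section Defs.
Variables (R : realType) (d : measure_display) (E : measurableType d).

Definition borel_space : Prop :=
  exists f : E -> R, [/\ measurable_fun setT f, injective f,
    measurable (range f) & forall A, measurable A -> measurable (f @` A)].

Definition substochastic_kernel (K : set E -> E -> R) : Prop :=
  (forall x, exists m : {measure set E -> \bar R},
      forall B, measurable B -> m B = (K B x)%:E) /\
  (forall x, K setT x <= 1) /\
  (forall B, measurable B -> measurable_fun setT (K B)).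

Definition stochastic_kernel (K : set E -> E -> R) : Prop :=
  substochastic_kernel K /\ (forall x, K setT x = 1).

Definition semi_Markov_kernel (Q : R -> set E -> E -> R) : Prop :=
  [/\ (forall B x, measurable B -> forall t1 t2, 0 <= t1 -> t1 <= t2 ->
          Q t1 B x <= Q t2 B x),
      (forall B x, measurable B -> forall t, 0 <= t ->
          (fun u => Q u B x) @ at_right t --> Q t B x),
      (forall B x, measurable B -> Q 0 B x = 0),
      (forall t, 0 <= t -> substochastic_kernel (Q t)) &
      (exists L : set E -> E -> R,
          (forall B x, measurable B -> (fun u => Q u B x) @ +oo --> L B x) /\
          stochastic_kernel L)].

Definition regular_kernel (Q : R -> set E -> E -> R) : Prop :=
  exists delta eps : R, [/\ 0 < delta, 0 < eps &
    forall x, Q delta setT x <= 1 - eps].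

(** mu x is the measure Q(dt, dy | x) on R_+ x E (seen on R x E, null on
    the negative half-line), determined by Q. *)
Definition kernel_measure (Q : R -> set E -> E -> R)
    (mu : E -> {measure set (R * E)%type -> \bar R}) : Prop :=
  (forall x t B, 0 <= t -> measurable B ->
     mu x (`[0%R, t] `*` B) = (Q t B x)%:E) /\
  (forall x, mu x (`]-oo, 0[ `*` setT) = 0%E).

(** canonical path space: omega n = (t_n, x_n); the first time coordinate
    t_0 is a dummy (T_0 := 0) and is not part of the sigma-algebra. *)
Definition path := nat -> (R * E)%type.

Definition gen_F (n : nat) : set (set path) :=
  [set C | exists A : set E, measurable A /\
             C = (fun w : path => (w 0%N).2) @^-1` A]
  `|` [set C | exists (k : nat) (A : set (R * E)%type),
             [/\ (1 <= k <= n)%N, measurable A & C = (fun w : path => w k) @^-1` A]].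

Definition gen_all : set (set path) := \bigcup_n gen_F n.

Definition Omega := g_sigma_algebraType gen_all.

Definition F (n : nat) : set (set Omega) := <<s gen_F n >>.

Definition X (n : nat) (w : Omega) : E := (w n).2.
Definition Tn (n : nat) (w : Omega) : R := if n is 0 then 0 else (w n).1.
Definition S (n : nat) (w : Omega) : R := \sum_(k < n.+1) Tn k w.

Definition path_measures (Q : R -> set E -> E -> R)
    (P : E -> probability Omega R) : Prop :=
  (forall x, P x [set w | X 0 w = x] = 1%E) /\
  (forall x n (A : set Omega) t B, F n A -> 0 <= t -> measurable B ->
     P x (A `&` [set w | Tn n.+1 w <= t /\ X n.+1 w \in B]) =
     (\int[P x]_(w in A) (Q t B (X n w))%:E)%E).

(** stopping times tau : Omega -> N u {+oo} (None = +oo) *)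
Definition stopping_time (tau : Omega -> option nat) : Prop :=
  forall n, F n [set w | tau w = Some n].

Definition Sinf (w : Omega) : \bar R := limn (fun n => (S n w)%:E).

Definition Stau (tau : Omega -> option nat) (w : Omega) : \bar R :=
  match tau w with Some n => (S n w)%:E | None => Sinf w end.

Definition Xt (w : Omega) (t : R) : E :=
  xget (X 0 w) [set y | exists n, (S n w <= t < S n.+1 w) /\ y = X n w].

Definition reward (c g : E -> R) (s : R) (tau : Omega -> option nat)
    (w : Omega) : \bar R :=
  if (Stau tau w < s%:E)%E then
    (\int[lebesgue_measure]_(t in `[0%R, fine (Stau tau w)]) (c (Xt w t))%:E
      + (g (Xt w (fine (Stau tau w))))%:E)%E
  else (\int[lebesgue_measure]_(t in `[0%R, s]) (c (Xt w t))%:E)%E.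

Definition Vtau (P : E -> probability Omega R) (c g : E -> R)
    (tau : Omega -> option nat) (s : R) (x : E) : \bar R :=
  (\int[P x]_w reward c g s tau w)%E.

Definition Vstar (P : E -> probability Omega R) (c g : E -> R)
    (s : R) (x : E) : \bar R :=
  ereal_inf [set Vtau P c g tau s x | tau in [set tau | stopping_time tau]].

Definition Gop (Q : R -> set E -> E -> R)
    (mu : E -> {measure set (R * E)%type -> \bar R}) (c g : E -> R)
    (u : R -> E -> \bar R) (s : R) (x : E) : \bar R :=
  mine ((c x)%:E * \int[lebesgue_measure]_(t in `[0%R, s]) (1 - Q t setT x)%R%:E
        + \int[mu x]_(p in `[0%R, s] `*` setT) u (s - p.1)%R p.2)%E
       (g x)%:E.

Definition Vseq (Q : R -> set E -> E -> R)
    (mu : E -> {measure set (R * E)%type -> \bar R}) (c g : E -> R)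
    (n : nat) : R -> E -> \bar R :=
  iter n (Gop Q mu c g) (fun _ _ => 0%E).

End Defs.

(* Main.v *)
Require Import Defs.
From HB Require Import structures.
From mathcomp Require Import all_boot all_order all_algebra.
From mathcomp Require Import all_classical all_reals all_analysis.
From mathcomp Require Import measurable_realfun.
From mathcomp Require Import lra.
Set Implicit Arguments. Unset Strict Implicit. Unset Printing Implicit Defensive.
Import Order.TTheory GRing.Theory Num.Theory.
Import numFieldNormedType.Exports.
Local Open Scope classical_set_scope.
Local Open Scope ring_scope.

(** The reward of a stopping time is almost surely a series of nonnegative
    stage rewards: the running cost over the [j]-th sojourn while the process
    is not stopped, the terminal cost at the stage where it stops before the
    horizon.  The Markov property is used one step at a time: conditionally on
    [F k], the next pair (sojourn time, state) has law [Q(., . | X_k)].  For an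
    event [A] of [F k] on which the process has not stopped before stage [k],
    splitting [A] according to whether it stops at [k] and iterating the
    one-step formula, one bounds the expected value of the next [m] stage
    rewards on [A]
    - from below by that of [V_m (s - S_k) X_k], for any stopping time;
    - from above by that of [U (s - S_k) X_k], where [U] is the limit of the
      nondecreasing sequence [V_n], for the first [k] such that [S_k < s] and
      [g X_k <= U (s - S_k) X_k].  Before that stage [U = min(W U, g)] is equal
      to [W U], so the one-step formula holds with equality.
    Letting [m] tend to infinity at [k = 0] gives [V* = U].  Regularity enters
    through [E exp(- S_n) <= rho ^ n] with [rho < 1], which excludes explosion
    and identifies the reward of a path that never stops. *)

(** * Measures on rectangles and disintegration *)

Section RayRectangles.
Context (R : realType) (d : measure_display) (E : measurableType d).

(** The rays start at minus infinity so that these sets also reach negative times: they form a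
    pi-system that covers [R * E] and generates its sigma-algebra. *)
Definition ray_rect : set (set (R * E)) :=
  [set C | exists (t : R) (B : set E),
    measurable B /\ C = `]-oo, t]%classic `*` B].

Lemma bigcup_ray : \bigcup_n `]-oo, n%:R]%classic = [set: R].
Proof.
apply/seteqP; split=> // x _; exists (Num.Def.trunc x).+1 => //=.
by rewrite in_itv/= ltW// truncnS_gt.
Qed.

Lemma ray_rect_setI : setI_closed ray_rect.
Proof.
move=> _ _ [t1 [B1 [mB1 ->]]] [t2 [B2 [mB2 ->]]].
exists (Num.min t1 t2), (B1 `&` B2); split; first exact: measurableI.
apply/seteqP; split=> -[t y]/=; rewrite !in_itv/= le_min.
  by move=> [[-> ?] [-> ?]].
by move=> [/andP[-> ->] []].
Qed.

Lemma bigcup_ray_rect (B : set E) :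
  \bigcup_n (`]-oo, n%:R]%classic `*` B) = [set: R] `*` B.
Proof. by rewrite -setX_bigcupl bigcup_ray. Qed.

Lemma measurable_ray_rect : @measurable _ (R * E)%type = <<s ray_rect >>.
Proof.
apply/seteqP; split; last first.
  apply: smallest_sub; first exact: sigma_algebra_measurable.
  by move=> _ [t [B [mB ->]]]; apply: measurableX.
apply: smallest_sub; first exact: smallest_sigma_algebra.
(* It is enough that both projections are measurable for the generated sigma-algebra. A preimage
   under [snd] is a countable union of ray rectangles; the preimage of an open upper half-line under
   [fst] is the complement of one. *)
have msnd : measurable_fun setT (snd : g_sigma_algebraType ray_rect -> E).
  move=> _ B mB; rewrite setTI -[_ @^-1` _]setTX -bigcup_ray_rect.
  apply: bigcupT_measurable => n; apply: sub_sigma_algebra.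
  by exists n%:R, B.
have mfst : measurable_fun setT (fst : g_sigma_algebraType ray_rect -> R).
  apply: (measurability _ (RGenOInfty.measurableE R)) => _ /= [_ [t ->] <-].
  rewrite setTI -setCitvl preimage_setC; apply: measurableC.
  apply: sub_sigma_algebra; exists t, setT; split => //.
  by apply/seteqP; split=> // -[x y] [].
rewrite subUset; split => _ [B mB <-].
  exact: mfst.
exact: msnd.
Qed.

End RayRectangles.

Section Disintegration.
Context (d1 d2 : measure_display) (Y : measurableType d1)
  (Z : measurableType d2) (R : realType).
Variables (p : pprobability Y R) (k : R.-pker Y ~> Z).

(** The [unit] component is the parameter required by [kcomp]. *)
Definition joint (q : unit * Y) : set (Y * Z) -> \bar R :=
  pushforward (k q.2) (pair q.2).

Let joint0 q : joint q set0 = 0%E.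
Proof. by rewrite /joint /pushforward preimage_set0 measure0. Qed.

Let joint_ge0 q D : (0 <= joint q D)%E.
Proof. exact: measure_ge0. Qed.

Let joint_additive q : semi_sigma_additive (joint q).
Proof.
apply: (@measure_semi_sigma_additive _ _ _ (pushforward (k q.2) (pair q.2))).
exact: pair1_measurable.
Qed.

HB.instance Definition _ q := isMeasure.Build _ _ _ (joint q)
  (joint0 q) (joint_ge0 q) (@joint_additive q).

Definition joint_kernel : unit * Y -> {measure set (Y * Z) -> \bar R} := joint.

Let measurable_joint D : measurable D ->
  measurable_fun setT (joint_kernel ^~ D).
Proof.
move=> mD; rewrite [X in measurable_fun _ X](_ : _ =
  (fun y => k y (xsection D y)) \o snd); last first.
  apply/funext => -[u y] /=; rewrite /joint_kernel/= /joint /pushforward/=.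
  by rewrite xsectionE.
apply: measurableT_comp => //; apply: measurable_fun_xsection_finite_kernel.
by rewrite inE.
Qed.

HB.instance Definition _ := @isKernel.Build _ _ _ _ R joint_kernel
  measurable_joint.

Let joint_prob q : joint_kernel q setT = 1%E.
Proof.
by rewrite /joint_kernel/= /joint/= /pushforward preimage_setT prob_kernel.
Qed.

HB.instance Definition _ := @Kernel_isProbability.Build _ _ _ _ R joint_kernel
  joint_prob.

(** The measure [m] and the composition of [p] with [k] agree on the rectangles with second side in
    [G], a pi-system generating the product sigma-algebra, and [m] is finite; hence they
    coincide. *)
Lemma disintegration (G : set (set Z)) (g : (set Z)^nat)
    (m : {measure set (Y * Z) -> \bar R}) (f : Y * Z -> \bar R) :
  @measurable _ Z = <<s G >> -> setI_closed G ->
  (forall n, G (g n)) -> \bigcup_n g n = setT -> (m setT < +oo)%E ->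
  (forall A B, measurable A -> G B ->
     m (A `*` B) = (\int[p]_(y in A) k y B)%E) ->
  (forall z, 0 <= f z)%E -> measurable_fun setT f ->
  (\int[m]_z f z = \int[p]_y \int[k y]_z f (y, z))%E.
Proof.
move=> mG IG Gg gT moo mAB f0 mf.
(* Viewing [p] as a constant kernel makes [kcomp l joint_kernel tt] the law of a pair drawn first
   from [p], then from [k]. *)
pose l : R.-pker unit ~> Y :=
  kprobability (measurable_cst p : measurable_fun [set: unit] (cst p)).
pose H := [set A `*` B | A in @measurable _ Y & B in G].
have GZ B : G B -> measurable B by move=> GB; rewrite mG; exact: sub_sigma_algebra.
have mH : @measurable _ (Y * Z)%type = <<s H >>.
  apply/seteqP; split; last first.
    apply: smallest_sub; first exact: sigma_algebra_measurable.
    by move=> _ [A mA] [B /GZ mB] <-; exact: measurableX.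
  apply: smallest_sub; first exact: smallest_sigma_algebra.
  rewrite subUset; split => _ [B mB <-]; rewrite setTI.
    (* [setT] need not belong to [G], so the cylinder over [B] is assembled from the cover [g]. *)
    rewrite (_ : _ @^-1` _ = \bigcup_n (B `*` g n)); last first.
      by rewrite -setX_bigcupr gT; apply/seteqP; split=> -[y z] // [].
    apply: sigma_algebra_bigcup => n; apply: sub_sigma_algebra.
    by exists B => //; exists (g n).
  have msnd : measurable_fun setT (snd : g_sigma_algebraType H -> Z).
    apply: (measurability _ mG) => _ [C GC <-].
    rewrite setTI; apply: sub_sigma_algebra; exists setT => //; exists C => //.
    by apply/seteqP; split=> -[y z] // [].
  by rewrite -[X in _ X]setTI; exact: msnd.
have IH : setI_closed H.
  move=> _ _ [A1 mA1] [B1 GB1 <-] [A2 mA2] [B2 GB2 <-].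
  exists (A1 `&` A2); first exact: measurableI.
  exists (B1 `&` B2); first exact: IG.
  by rewrite setXI.
have mE D : measurable D -> m D = kcomp l joint_kernel tt D.
  apply: (measure_unique H (fun n => setT `*` g n)) => //.
  - by move=> n; exists setT => //; exists (g n).
  - by rewrite -setX_bigcupr gT setXTT.
  - move=> _ [A mA] [B GB <-]; rewrite mAB// /kcomp integral_mkcond.
    apply: eq_integral => y _; rewrite patchE /= /joint_kernel/= /joint/= /pushforward.
    case: ifPn => [|] yA.
      by congr (k y _); apply/seteqP; split=> z /= => [Bz|[]]; [split=> //; exact: set_mem|].
    rewrite -[LHS](measure0 (k y)); congr (k y _).
    by apply/seteqP; split=> z //= -[] /mem_set; rewrite (negbTE yA).
  - move=> n; apply: le_lt_trans moo; apply: le_measure; rewrite ?inE//.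
    by apply: measurableX => //; exact: GZ.
rewrite (eq_measure_integral (kcomp l joint_kernel tt)); last first.
  by move=> D mD _; exact: mE.
rewrite integral_kcomp//=; apply: eq_integral => y _ /=.
rewrite ge0_integral_pushforward//.
Qed.
End Disintegration.

(** * The measure of a semi-Markov kernel *)

(** The equality of functions in the conclusion allows a given family of measures to be replaced by
    a bundled kernel. *)
Lemma pker_exists d1 d2 (X : measurableType d1) (Y : measurableType d2)
    (R : realType) (k : X -> {measure set Y -> \bar R}) :
  (forall U, measurable U -> measurable_fun setT (k ^~ U)) ->
  (forall x, k x setT = 1%E) ->
  exists K : R.-pker X ~> Y, (K : X -> {measure set Y -> \bar R}) = k.
Proof.
move=> mk k1.
pose m1 := isKernel.Build _ _ _ _ R k mk.
pose K1 : R.-ker X ~> Y := HB.pack k m1.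
pose m2 := Kernel_isProbability.Build _ _ _ _ R K1 k1.
pose K : R.-pker X ~> Y := HB.pack k m1 m2.
by exists K.
Qed.

Lemma pker_comp d0 d1 d2 (X' : measurableType d0) (X : measurableType d1)
    (Y : measurableType d2) (R : realType) (K : R.-pker X ~> Y) (f : X' -> X) :
  measurable_fun setT f ->
  exists K' : R.-pker X' ~> Y,
    (K' : X' -> {measure set Y -> \bar R}) = fun x => K (f x).
Proof.
move=> mf; apply: pker_exists => [U mU|x]; last exact: prob_kernel.
exact: measurableT_comp (measurable_kernel K U mU) mf.
Qed.

Section KernelMeasure.
Context (R : realType) (d : measure_display) (E : measurableType d).
Variables (Q : R -> set E -> E -> R)
  (mu : E -> {measure set (R * E)%type -> \bar R}).
Hypotheses (HQ : semi_Markov_kernel Q) (Hmu : kernel_measure Q mu).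

Lemma kernel_measure_neg x (A : set (R * E)) :
  measurable A -> A `<=` `]-oo, 0[%classic `*` setT -> mu x A = 0%E.
Proof.
move=> mA A0; apply: (subset_measure0 mA _ A0) => //.
  exact: measurableX.
exact: Hmu.2.
Qed.

Lemma kernel_measure_ray x t (B : set E) : measurable B ->
  mu x (`]-oo, t]%classic `*` B) = if 0 <= t then (Q t B x)%:E else 0%E.
Proof.
move=> mB; case: ifPn => [t0|]; last first.
  rewrite -ltNge => t0; apply: kernel_measure_neg; first exact: measurableX.
  move=> [u y] [/=]; rewrite !in_itv/= => ut _; split => //.
  exact: le_lt_trans ut t0.
rewrite (_ : _ `*` _ = (`]-oo, 0[%classic `*` B) `|` (`[0, t]%classic `*` B)).
  rewrite measureU; [|exact: measurableX|exact: measurableX|].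
    rewrite -[RHS]add0e; congr (_ + _)%E; last exact: Hmu.1.
    apply: kernel_measure_neg; first exact: measurableX.
    by move=> [u y] [? ?].
  rewrite -subset0 => -[u y] [[/= + _] [/= + _]]; rewrite !in_itv/= => u0.
  by move=> /andP[]; rewrite leNgt u0.
apply/seteqP; split=> -[u y]/=; rewrite !in_itv/=.
  move=> [ut By]; have [u0|u0] := leP 0 u; first by right; rewrite ut.
  by left.
by move=> [[/ltW u0 By]|[/andP[_ ut] By]]; split=> //; exact: le_trans u0 t0.
Qed.

(** The rays up to [n] increase to the whole line, and their masses [Q n%:R setT x] tend to the mass
    of the limiting kernel, which is stochastic. *)
Lemma kernel_measureT x : mu x setT = 1%E.
Proof.
have [_ _ _ _ [L [QL [_ L1]]]] := HQ.
have mR n : measurable (`]-oo, n%:R]%classic `*` setT : set (R * E)).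
  exact: measurableX.
have := @nondecreasing_cvg_mu _ _ _ (mu x)
  (fun n : nat => `]-oo, n%:R]%classic `*` setT : set (R * E)).
rewrite bigcup_ray_rect setXTT => /(_ mR measurableT) mu1.
have {}mu1 : (Q n%:R setT x)%:E @[n --> \oo] --> mu x setT.
  rewrite (_ : (fun n => _) = mu x \o (fun n : nat => `]-oo, n%:R]%classic `*` setT)).
    apply: mu1 => m n mn; apply/subsetPset => -[u y] [/= um _]; split => //.
    move: um; rewrite /= !in_itv/= => /le_trans; apply.
    by rewrite ler_nat.
  by apply/funext => n /=; rewrite kernel_measure_ray// ler0n.
have Q1 : (Q n%:R setT x)%:E @[n --> \oo] --> 1%E.
  apply: cvg_EFin; first by near=> n.
  have := cvg_comp (fun n : nat => n%:R) (fun u => Q u setT x) (@cvgr_idn R)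
    (QL setT x measurableT).
  by rewrite L1.
by move/cvg_lim : mu1 => <-//; exact/cvg_lim.
Unshelve. all: by end_near. Qed.

(** Dynkin induction from the ray rectangles, where the value is [Q t B x] or zero; complements are
    subtracted from the total mass 1 and disjoint unions become series. *)
Lemma measurable_kernel_measure U : measurable U ->
  measurable_fun setT (mu ^~ U).
Proof.
have mR := @measurable_ray_rect R d E.
have mufin x : (mu x setT < +oo)%E by rewrite kernel_measureT ltry.
move=> mU; have sU : <<s @ray_rect R d E >> U by rewrite -mR.
apply: (dynkin_induction (P := fun U => measurable_fun setT (mu ^~ U))
  mR _ _ _ _ _ sU).
- exact: ray_rect_setI.
- rewrite (_ : mu ^~ setT = cst 1%E)//.
  by apply/funext => x; rewrite kernel_measureT.
- move=> _ [t [B [mB ->]]].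
  rewrite (_ : mu ^~ _ = fun x => if 0 <= t then (Q t B x)%:E else 0%E).
    case: (boolP (0 <= t)) => // t0; apply/measurable_EFinP.
    have [_ _ _ Qt _] := HQ.
    by have [_ [_]] := Qt t t0; apply.
  by apply/funext => x; rewrite kernel_measure_ray.
- move=> S mS mfS.
  rewrite (_ : mu ^~ _ = fun x => (mu x setT - mu x S)%E).
    apply: emeasurable_funB => //.
    rewrite (_ : mu ^~ setT = cst 1%E)//.
    by apply/funext => x; rewrite kernel_measureT.
  apply/funext => x; rewrite -setTD measureD// ?setTI//.
  exact: mufin.
- move=> F mF tF mfF.
  rewrite (_ : mu ^~ _ = fun x => (\sum_(n <oo) mu x (F n))%E).
    by apply: ge0_emeasurable_sum.
  by apply/funext => x; rewrite measure_semi_bigcup//; exact: bigcupT_measurable.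
Qed.

Lemma kernel_measure_pker :
  exists K : R.-pker E ~> (R * E)%type,
    (K : E -> {measure set (R * E)%type -> \bar R}) = mu.
Proof.
by apply: pker_exists; [exact: measurable_kernel_measure|exact: kernel_measureT].
Qed.

End KernelMeasure.

(** * The one-step operator and value iteration *)

Section Operator.
Context (R : realType) (d : measure_display) (E : measurableType d).
Variables (Q : R -> set E -> E -> R) (K : R.-pker E ~> (R * E)%type).
Variables (c g : E -> R).
Hypotheses (HK : kernel_measure Q K).
Hypotheses (mc : measurable_fun setT c) (mg : measurable_fun setT g).
Hypotheses (c0 : forall x, 0 <= c x) (g0 : forall x, 0 <= g x).

Lemma kernel_tail x t : 0 <= t ->
  (1 - Q t setT x)%:E = K x (`]t, +oo[%classic `*` setT).
Proof.
move=> t0.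
have mR : measurable (`]-oo, t]%classic `*` setT : set (R * E)).
  exact: measurableX.
have -> : `]t, +oo[%classic `*` setT =
    ~` (`]-oo, t]%classic `*` setT) :> set (R * E).
  apply/seteqP; split => -[u y] /=; rewrite !in_itv/= andbT.
    by move=> [tu _] [ut _]; move: tu; rewrite ltNge ut.
  by move=> H; split=> //; rewrite ltNge; apply/negP => ut; apply: H.
have := kernel_measure_ray HK x t measurableT; rewrite t0 => KR.
have KT : K x setT = 1%E by exact: prob_kernel.
have Kfin : (K x setT < +oo)%E by rewrite KT ltry.
rewrite -setTD measureD// setTI.
by rewrite EFinB; congr (_ - _)%E; exact/esym.
Qed.

Lemma ae_kernel_ge0 x : \forall p \ae K x, 0 <= p.1.
Proof.
exists (`]-oo, 0[%classic `*` setT); split; first exact: measurableX.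
  exact: HK.2.
move=> -[u y] /=; rewrite in_itv/= => u0; split=> //.
by rewrite ltNge; apply/negP.
Qed.

(** The part of a sojourn of length [t] that falls before the horizon [s]. The outer maximum makes
    it vanish once the remaining horizon is negative. *)
Definition clamp (t s : R) : R := Num.max 0 (Num.min t s).

Lemma clamp_ge0 t s : 0 <= clamp t s.
Proof. by rewrite /clamp le_max lexx. Qed.

Lemma measurable_clamp d' (T : measurableType d') (f h : T -> R) :
  measurable_fun setT f -> measurable_fun setT h ->
  measurable_fun setT (fun w => clamp (f w) (h w)).
Proof.
move=> mf mh; apply: measurable_maxr => //; exact: measurable_minr.
Qed.

Lemma lebesgue_clamp (s u : R) : 0 <= s ->
  lebesgue_measure (`[0, s]%classic `&` `]-oo, u[%classic) = (clamp u s)%:E.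
Proof.
move=> s0; rewrite /clamp.
have [us|su] := leP u s.
  rewrite (_ : _ `&` _ = `[0, u[%classic); last first.
    apply/seteqP; split => t /=; rewrite !in_itv/=.
      by move=> [/andP[-> _] ->].
    by move=> /andP[-> tu]; rewrite tu (le_trans (ltW tu)).
  rewrite lebesgue_measure_itv/= lte_fin.
  by case: ltP => u0; rewrite ?oppr0 ?sube0 ?addr0.
rewrite (_ : _ `&` _ = `[0, s]%classic); last first.
  apply/seteqP; split => t /=; rewrite !in_itv/=; first by case.
  by move=> ts; split => //; case/andP: ts => _ /le_lt_trans; exact.
rewrite lebesgue_measure_itv/= lte_fin.
by case: ltP => u0; rewrite ?oppr0 ?sube0 ?addr0.
Qed.

(** By [kernel_tail], [1 - Q t setT x] is the probability that the sojourn exceeds [t]. Tonelli for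
    the indicator of [A] then exchanges the two integrals, and each section in [t] has length
    [clamp p.1 s]. *)
Lemma holding_time x (s : R) : 0 <= s ->
  (\int[lebesgue_measure]_(t in `[0%R, s]) (1 - Q t setT x)%:E =
   \int[K x]_p (clamp p.1 s)%:E)%E.
Proof.
move=> s0.
pose A := [set q : R * (R * E) | (0 <= q.1 <= s) && (q.1 < q.2.1)].
pose f (tp : R * (R * E)) : \bar R := (\1_A tp)%:E.
have mA : measurable A.
  rewrite (_ : A = (fst @^-1` `[0, s]%classic) `&`
      ((fun q => q.2.1 - q.1) @^-1` `]0, +oo[%classic)); last first.
    apply/seteqP; split => q; rewrite /A /= !in_itv/= andbT subr_gt0.
      by move/andP.
    by move=> [-> ->].
  apply: measurableI; rewrite -[X in measurable X]setTI.
    exact: measurable_fst.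
  have mh : measurable_fun setT (fun q : R * (R * E) => q.2.1 - q.1).
    by apply: measurable_funB => //; exact: measurableT_comp.
  exact: mh.
have mf : measurable_fun setT f.
  by apply/measurable_EFinP; exact: measurable_indic.
pose Kx : {sfinite_measure set (R * E)%type -> \bar R} :=
  HB.pack (K x : set (R * E) -> \bar R)
   (Measure.on (K x)) (isSFinite.Build _ _ _ (K x) (sfinite_kernel_measure K x)).
have := @sfinite_Fubini _ _ _ _ R lebesgue_measure Kx f _ mf.
have f0 z : (0 <= f z)%E by rewrite lee_fin.
move=> /(_ f0) fub.
rewrite [LHS]integral_mkcond.
transitivity (\int[lebesgue_measure]_t \int[Kx]_p f (t, p))%E.
  apply: eq_integral => t _; rewrite patchE.
  case: ifPn => [|] ts.
    have /= := set_mem ts; rewrite in_itv/= => /andP[t0 tS].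
    rewrite kernel_tail//.
    rewrite (_ : (fun p => f (t, p)) = fun p => (\1_(`]t, +oo[%classic `*` setT) p)%:E).
      by rewrite integral_indic ?setIT//; exact: measurableX.
    apply/funext => p; rewrite /f !indicE; congr ((nat_of_bool _)%:R%:E).
    apply/idP/idP; rewrite !inE /A/= in_itv/= andbT t0 tS/=; first by split.
    by case.
  rewrite integral0_eq// => p _; rewrite /f indicE memNset// /A /=.
  by move=> /andP[ts' _]; move: ts; rewrite notin_setE/= in_itv/=.
rewrite fub; apply: eq_integral => p _.
rewrite (_ : (fun t => f (t, p)) =
   fun t => (\1_(`[0, s]%classic `&` `]-oo, p.1[%classic) t)%:E).
  rewrite integral_indic ?setIT//; last exact: measurableI.
  exact: lebesgue_clamp.
apply/funext => t; rewrite /f !indicE; congr ((nat_of_bool _)%:R%:E).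
apply/idP/idP; rewrite !inE /A/= !in_itv/=; first by move/andP.
by move=> [-> ->].
Qed.

(** The cost of continuing for one sojourn and then paying [u] with the remaining horizon. The
    integral runs over all sojourn times, so no indicator of [[0, s]] has to be carried through the
    one-step formula. *)
Definition W (u : R -> E -> \bar R) (s : R) (x : E) : \bar R :=
  (\int[K x]_p ((c x * clamp p.1 s)%:E + u (s - p.1)%R p.2))%E.

Lemma measurable_shift u s :
  measurable_fun setT (fun q : R * E => u q.1 q.2) ->
  measurable_fun setT (fun p : R * E => u (s - p.1)%R p.2 : \bar R).
Proof.
move=> mu; have mp : measurable_fun setT (fun p : R * E => (s - p.1, p.2)).
  by apply: measurable_fun_pair => //; exact: measurable_funB.
exact: (measurableT_comp mu mp).
Qed.

Lemma GopE (u : R -> E -> \bar R) s x :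
  (forall r y, 0 <= u r y)%E -> (forall r y, r <= 0 -> u r y = 0%E) ->
  measurable_fun setT (fun q : R * E => u q.1 q.2) ->
  Gop Q K c g u s x = mine (W u s x) (g x)%:E.
Proof.
move=> u0 un mu; rewrite /Gop /W; congr (mine _ _).
have mcl : measurable_fun setT (fun p : R * E => (clamp p.1 s)%:E).
  by apply/measurable_EFinP; exact: measurable_clamp.
have mus := measurable_shift s mu.
under [RHS]eq_integral do rewrite EFinM.
rewrite ge0_integralD//=; last 2 first.
- by move=> p _; rewrite mule_ge0 ?lee_fin ?clamp_ge0.
- exact: measurable_funeM.
congr (_ + _)%E.
  rewrite ge0_integralZl//; last 2 first.
    by move=> p _; rewrite lee_fin clamp_ge0.
    by rewrite lee_fin.
  congr (_ * _)%E; have [s0|s0] := leP 0 s; first exact: holding_time.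
  (* For a negative horizon the interval is empty and the clamp is zero. *)
  rewrite set_itv_ge ?bnd_simp -?ltNge// integral_set0 integral0_eq// => p _.
  by rewrite /clamp max_l// ge_min (ltW s0) orbT.
have mS : measurable (`[0, s]%classic `*` setT : set (R * E)).
  exact: measurableX.
rewrite [LHS]integral_mkcond; apply: ge0_ae_eq_integral => //.
- by apply/(measurable_restrictT _ _).1 => //; exact: measurable_funTS.
- by move=> p _; apply: erestrict_ge0.
- apply: filterS (ae_kernel_ge0 x) => -[t y] /= t0 _.
  rewrite patchE; case: ifPn => //; rewrite notin_setE/= in_itv/= t0/= => ts.
  rewrite un// subr_le0 leNgt; apply/negP => st; apply: ts; split=> //.
  exact: ltW.
Qed.

Section W.
Variables (u v : R -> E -> \bar R).
Hypotheses (u0 : forall r y, (0 <= u r y)%E) (v0 : forall r y, (0 <= v r y)%E).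
Hypotheses (mu : measurable_fun setT (fun q : R * E => u q.1 q.2))
  (mv : measurable_fun setT (fun q : R * E => v q.1 q.2)).

Lemma W_integrand_ge0 s x (p : R * E) :
  (0 <= (c x * clamp p.1 s)%:E + u (s - p.1)%R p.2)%E.
Proof. by rewrite adde_ge0// lee_fin mulr_ge0// clamp_ge0. Qed.

(** Horizon, state and next pair are all functions of a common variable, so that the same fact
    serves for fixed [s] and [x], for parameters, and along a path. *)
Lemma measurable_W_integrand d' (T : measurableType d') (fs : T -> R)
    (fx : T -> E) (fp : T -> R * E) :
  measurable_fun setT fs -> measurable_fun setT fx -> measurable_fun setT fp ->
  measurable_fun setT (fun w =>
    (c (fx w) * clamp (fp w).1 (fs w))%:E + u (fs w - (fp w).1)%R (fp w).2)%E.
Proof.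
move=> mfs mfx mfp.
have mfp1 : measurable_fun setT (fun w => (fp w).1) by exact: measurableT_comp.
have mfp2 : measurable_fun setT (fun w => (fp w).2) by exact: measurableT_comp.
apply: emeasurable_funD.
  apply/measurable_EFinP; apply: measurable_funM; first exact: measurableT_comp.
  exact: measurable_clamp.
have mpair : measurable_fun setT (fun w => (fs w - (fp w).1, (fp w).2)).
  by apply: measurable_fun_pair => //; exact: measurable_funB.
exact: (measurableT_comp mu mpair).
Qed.

Lemma W_ge0 s x : (0 <= W u s x)%E.
Proof. by apply: integral_ge0 => p _; exact: W_integrand_ge0. Qed.

Lemma W_eq0 s x : (forall r y, r <= 0 -> u r y = 0%E) -> s <= 0 -> W u s x = 0%E.
Proof.
move=> un s0; rewrite /W (_ : 0%E = (\int[K x]_p (cst 0%E p))%E); last first.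
  by rewrite integral0.
apply: ge0_ae_eq_integral => //.
- exact: (@measurable_W_integrand _ _ (cst s) (cst x) id).
- by move=> p _; exact: W_integrand_ge0.
- apply: filterS (ae_kernel_ge0 x) => p p0 _ /=.
  rewrite un ?subr_le0 ?(le_trans s0)// /clamp max_l ?mulr0 ?adde0//.
  by rewrite ge_min s0 orbT.
Qed.

Lemma measurable_W : measurable_fun setT (fun q : R * E => W u q.1 q.2).
Proof.
have [K' K'E] := @pker_comp _ _ _ (R * E)%type _ _ _ K snd measurable_snd.
have := @measurable_fun_integral_finite_kernel _ _ _ _ _
  (fun z : (R * E) * (R * E) =>
    ((c z.1.2 * clamp z.2.1 z.1.1)%:E + u (z.1.1 - z.2.1)%R z.2.2)%E) K'.
have K'q q : (K' q : {measure set _ -> \bar R}) = K q.2.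
  exact: (congr1 (fun k => k q) K'E).
rewrite (_ : (fun q => W u q.1 q.2) = fun q => (\int[K' q]_p
    ((c q.2 * clamp p.1 q.1)%:E + u (q.1 - p.1)%R p.2))%E); last first.
  by apply/funext => q; rewrite /W -K'q.
apply; first by move=> z; exact: W_integrand_ge0.
by apply: (@measurable_W_integrand _ _ (fun z => z.1.1) (fun z => z.1.2) snd);
  try exact: measurableT_comp.
Qed.

Lemma le_W s x : (forall r y, u r y <= v r y)%E -> (W u s x <= W v s x)%E.
Proof.
move=> uv; apply: ge0_le_integral => //.
- by move=> p _; exact: W_integrand_ge0.
- exact: (@measurable_W_integrand _ _ (cst s) (cst x) id).
- apply: emeasurable_funD; last exact: measurable_shift.
  by apply/measurable_EFinP; apply: measurable_funM => //; exact: measurable_clamp.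
- by move=> p _; rewrite leeD2l.
Qed.

End W.

Local Notation V := (Vseq Q K c g).

(** The three properties are proved together because [GopE], which gives the recursion its usable
    form, requires all of them at the previous stage. *)
Lemma Vseq_spec n : [/\ (forall r y, 0 <= V n r y)%E,
  (forall r y, r <= 0 -> V n r y = 0%E) &
  measurable_fun setT (fun q : R * E => V n q.1 q.2)].
Proof.
elim: n => [//|n [V0 Vn mV]].
have VE r y : V n.+1 r y = mine (W (V n) r y) (g y)%:E by exact: GopE.
split=> [r y|r y r0|].
- by rewrite VE le_min W_ge0//= lee_fin.
- by rewrite VE W_eq0// min_l// lee_fin.
- rewrite (_ : (fun q => _) = fun q : R * E => mine (W (V n) q.1 q.2) (g q.2)%:E).
    apply: measurable_mine; first exact: measurable_W.
    by apply/measurable_EFinP; exact: measurableT_comp.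
  by apply/funext => q; rewrite VE.
Qed.

Lemma Vseq_ge0 n r y : (0 <= V n r y)%E. Proof. by case: (Vseq_spec n). Qed.

Lemma Vseq_eq0 n r y : r <= 0 -> V n r y = 0%E.
Proof. by case: (Vseq_spec n) => _ + _; apply. Qed.

Lemma measurable_Vseq n : measurable_fun setT (fun q : R * E => V n q.1 q.2).
Proof. by case: (Vseq_spec n). Qed.

Lemma VseqS n s x : V n.+1 s x = mine (W (V n) s x) (g x)%:E.
Proof. by case: (Vseq_spec n) => *; exact: GopE. Qed.

Lemma Vseq_nd s x : nondecreasing_seq (fun n => V n s x).
Proof.
apply/nondecreasing_seqP => n; elim: n s x => [|n IH] s x.
  exact: Vseq_ge0.
rewrite !VseqS; apply: le_min2 => //; apply: le_W => //.
- exact: Vseq_ge0.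
- exact: measurable_Vseq.
- exact: measurable_Vseq.
Qed.

Definition Vlim s x : \bar R := ereal_sup (range (fun n => V n s x)).

Lemma cvg_Vseq s x : V n s x @[n --> \oo] --> Vlim s x.
Proof. by apply: ereal_nondecreasing_cvgn; exact: Vseq_nd. Qed.

Lemma Vseq_le_Vlim n s x : (V n s x <= Vlim s x)%E.
Proof. by apply: ereal_sup_ubound; exists n. Qed.

Lemma Vlim_ge0 s x : (0 <= Vlim s x)%E.
Proof. exact: le_trans (Vseq_ge0 0 s x) (Vseq_le_Vlim 0 s x). Qed.

Lemma Vlim_eq0 s x : s <= 0 -> Vlim s x = 0%E.
Proof.
move=> s0; apply/eqP; rewrite eq_le Vlim_ge0 andbT.
by apply: ge_ereal_sup => _ [n _ <-]; rewrite Vseq_eq0.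
Qed.

Lemma measurable_Vlim : measurable_fun setT (fun q : R * E => Vlim q.1 q.2).
Proof.
apply: (emeasurable_fun_cvg (fun n (q : R * E) => V n q.1 q.2)).
  exact: measurable_Vseq.
by move=> q _; exact: cvg_Vseq.
Qed.

(** One inequality is monotonicity of [W]. For the other, only points with [Vlim < g] matter: there
    every [V n.+1] is below [g], hence equal to [W (V n)], and monotone convergence passes to the
    limit. *)
Lemma Vlim_fixpoint s x : Vlim s x = mine (W Vlim s x) (g x)%:E.
Proof.
apply/eqP; rewrite eq_le; apply/andP; split.
  apply: ge_ereal_sup => _ [[|n] _ <-].
    rewrite le_min; apply/andP; split; last by rewrite lee_fin.
    by apply: W_ge0 => *; exact: Vlim_ge0.
  rewrite VseqS; apply: le_min2 => //; apply: le_W => //.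
  - exact: Vseq_ge0.
  - exact: measurable_Vseq.
  - exact: measurable_Vlim.
  - exact: Vseq_le_Vlim.
have [gV|Vg] := leP (g x)%:E (Vlim s x); first by rewrite ge_min gV orbT.
rewrite ge_min; apply/orP; left.
have WV n : W (V n) s x = V n.+1 s x.
  have := Vseq_le_Vlim n.+1 s x; rewrite VseqS => VV; rewrite min_l// ltW//.
  by have := le_lt_trans VV Vg; rewrite gt_min ltxx orbF.
have cW : W (V n) s x @[n --> \oo] --> W Vlim s x.
  pose h n (p : R * E) := ((c x * clamp p.1 s)%:E + V n (s - p.1)%R p.2)%E.
  have hlim p : h ^~ p @ \oo --> ((c x * clamp p.1 s)%:E + Vlim (s - p.1)%R p.2)%E.
    apply: cvgeD; [by []|exact: cvg_cst|exact: cvg_Vseq].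
  rewrite /W (_ : (fun p => _) = fun p => limn (h ^~ p)); last first.
    by apply/funext => p; apply/esym/cvg_lim.
  apply: cvg_monotone_convergence => //.
  - move=> n; apply: (@measurable_W_integrand (V n) _ _ _ (cst s) (cst x) id) => //.
    exact: measurable_Vseq.
  - move=> n p _; apply: W_integrand_ge0; exact: Vseq_ge0.
  - by move=> p _ m n mn; rewrite leeD2l//; exact: Vseq_nd.
move: cW; under eq_fun do rewrite WV.
move=> /cvg_lim <-//; apply: lime_le.
  by apply/cvg_ex; exists (Vlim s x); have := @cvg_Vseq s x; rewrite -cvg_shiftS.
by apply: nearW => n; exact: Vseq_le_Vlim.
Qed.

End Operator.

(** * The one-step Markov property *)

Section Filtration.
Context (R : realType) (d : measure_display) (E : measurableType d).

(** Path space with the sigma-algebra [F n] only, so that the integrand of the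
    one-step formula can depend on the whole past up to stage [n]. *)
Definition Past (n : nat) := g_sigma_algebraType (@gen_F R d E n).

Lemma gen_F_le m n : (m <= n)%N -> @gen_F R d E m `<=` @gen_F R d E n.
Proof.
move=> mn C [CX|[k [A [/andP[k1 km] mA ->]]]]; [by left|right].
by exists k, A; split=> //; rewrite k1 (leq_trans km).
Qed.

Lemma F_le m n (A : set (Omega R E)) : (m <= n)%N -> F m A -> F n A.
Proof. by move=> mn; apply: sub_sigma_algebra2; exact: gen_F_le. Qed.

Lemma F_measurable n (A : set (Omega R E)) : F n A -> measurable A.
Proof.
by apply: sub_sigma_algebra2 => C ?; exists n.
Qed.

Lemma measurable_past_le m n d' (T : measurableType d') (f : Omega R E -> T) :
  (m <= n)%N -> measurable_fun setT (f : Past m -> T) ->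
  measurable_fun setT (f : Past n -> T).
Proof. by move=> mn mf _ B mB; apply: (F_le mn); exact: mf. Qed.

Lemma measurable_past n d' (T : measurableType d') (f : Omega R E -> T) :
  measurable_fun setT (f : Past n -> T) ->
  measurable_fun setT (f : Omega R E -> T).
Proof. by move=> mf _ B mB; apply: (@F_measurable n); exact: mf. Qed.

Lemma measurable_past_coord n :
  measurable_fun setT ((fun w => w n.+1) : Past n.+1 -> R * E).
Proof.
move=> _ B mB; rewrite setTI; apply: sub_sigma_algebra; right.
by exists n.+1, B; rewrite leqnn.
Qed.

Lemma measurable_past_X n :
  measurable_fun setT (@X R d E n : Past n -> E).
Proof.
case: n => [|n].
  move=> _ B mB; rewrite setTI; apply: sub_sigma_algebra; left.
  by exists B.
exact: (measurableT_comp measurable_snd (@measurable_past_coord n)).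
Qed.

Lemma measurable_past_Tn n :
  measurable_fun setT (@Tn R d E n : Past n -> R).
Proof.
case: n => [|n]; first exact: measurable_cst.
exact: (measurableT_comp measurable_fst (@measurable_past_coord n)).
Qed.

Lemma SE0 (w : Omega R E) : S 0 w = 0.
Proof. by rewrite /S big_ord1. Qed.

Lemma SES n (w : Omega R E) : S n.+1 w = S n w + Tn n.+1 w.
Proof. by rewrite /S big_ord_recr. Qed.

Lemma measurable_past_S n :
  measurable_fun setT (@S R d E n : Past n -> R).
Proof.
elim: n => [|n IH].
  rewrite (_ : @S R d E 0 = cst 0); first exact: measurable_cst.
  by apply/funext => w; rewrite SE0.
rewrite (_ : @S R d E n.+1 = fun w => S n w + Tn n.+1 w); last first.
  by apply/funext => w; rewrite SES.
apply: measurable_funD; first exact: measurable_past_le IH.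
exact: measurable_past_Tn.
Qed.

End Filtration.

Section OneStep.
Context (R : realType) (d : measure_display) (E : measurableType d).
Variables (Q : R -> set E -> E -> R) (K : R.-pker E ~> (R * E)%type)
  (P : E -> probability (Omega R E) R).
Hypotheses (HQ : semi_Markov_kernel Q) (HK : kernel_measure Q K)
  (HP : path_measures Q P).

(** The one-step law at time 0, where [Q] vanishes. *)
Lemma Tn_gt0 x n : P x [set w | Tn n.+1 w <= 0] = 0%E.
Proof.
have [_ _ Q0 _ _] := HQ.
have := HP.2 x n setT 0 setT.
rewrite setTI => /(_ _ _ measurableT).
rewrite (_ : [set w | _ /\ _] = [set w | Tn n.+1 w <= 0]); last first.
  by apply/seteqP; split => w /=; [case|rewrite in_setT].
move=> ->//; last exact: (@measurableT _ (Past R E n)).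
by apply: integral0_eq => w _; rewrite Q0.
Qed.

Lemma measurable_one_step k (f : Past R E k * (R * E) -> \bar R) :
  (forall z, 0 <= f z)%E -> measurable_fun setT f ->
  measurable_fun setT
    ((fun w => \int[K (X k w)]_p f (w, p))%E : Past R E k -> \bar R).
Proof.
move=> f0 mf; have [Kk KkE] := pker_comp K (@measurable_past_X R d E k).
have Kkw w : (Kk w : {measure set _ -> \bar R}) = K (X k w).
  exact: (congr1 (fun k => k w) KkE).
rewrite (_ : (fun w => _) = fun w => (\int[Kk w]_p f (w, p))%E).
  exact: (@measurable_fun_integral_finite_kernel _ _ _ _ _ f Kk).
by apply/funext => w; rewrite Kkw.
Qed.

(** The image of [P x] under the map sending [w] to its past and its next pair is disintegrated over
    the past with kernel [K (X k w)]; on ray rectangles this is the defining property of [P]. *)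
Lemma one_step x k (A : set (Past R E k)) (f : Past R E k * (R * E) -> \bar R) :
  measurable A -> (forall z, 0 <= f z)%E -> measurable_fun setT f ->
  (\int[P x]_(w in (A : set (Omega R E))) f (w, w k.+1) =
   \int[P x]_(w in (A : set (Omega R E))) \int[K (X k w)]_p f (w, p))%E.
Proof.
move=> mA f0 mf.
have mid : measurable_fun setT (id : Omega R E -> Past R E k).
  by apply: (@measurable_past _ _ _ k); exact: measurable_id.
have mco : measurable_fun setT ((fun w => w k.+1) : Omega R E -> R * E).
  by apply: (@measurable_past _ _ _ k.+1); exact: measurable_past_coord.
have mphi : measurable_fun setT
    ((fun w => (w, w k.+1)) : Omega R E -> (Past R E k * (R * E))%type).
  exact: measurable_fun_pair.
(* The identity onto the coarser sigma-algebra: its law [p] is [P x] restricted to [F k]. *)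
pose idm : {mfun Omega R E >-> Past R E k} :=
  HB.pack (id : Omega R E -> Past R E k) (isMeasurableFun.Build _ _ _ _ _ mid).
pose phi : {mfun Omega R E >-> (Past R E k * (R * E))%type} :=
  HB.pack ((fun w => (w, w k.+1)) : Omega R E -> (Past R E k * (R * E))%type)
    (isMeasurableFun.Build _ _ _ _ _ mphi).
pose p : pprobability (Past R E k) R := distribution (P x) idm.
have [Kk KkE] := pker_comp K (@measurable_past_X R d E k).
have Kkw w : (Kk w : {measure set _ -> \bar R}) = K (X k w).
  exact: (congr1 (fun k => k w) KkE).
pose m := distribution (P x) phi.
have m1 : m setT = 1%E by exact: (@probability_setT _ _ _ m).
have mfin : (m setT < +oo)%E by rewrite m1 ltry.
(* The event [A] is absorbed into the integrand, since the disintegration concerns integrals over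
   the whole space. *)
pose f' := f \_ (A `*` setT).
have mAT : measurable (A `*` setT : set (Past R E k * (R * E))).
  exact: measurableX.
have mf' : measurable_fun setT f'.
  by apply/(measurable_restrictT _ _).1 => //; exact: measurable_funTS.
have f'0 z : (0 <= f' z)%E by exact: erestrict_ge0.
have f'E w q : f' (w, q) = if w \in A then f (w, q) else 0%E.
  by rewrite /f' patchE in_setX/= in_setT andbT.
transitivity (\int[m]_z f' z)%E.
  rewrite ge0_integral_pushforward// preimage_setT [LHS]integral_mkcond.
  by apply: eq_integral => w _; rewrite patchE /= f'E.
rewrite (@disintegration _ _ _ _ R p Kk (@ray_rect R d E)
  (fun n => `]-oo, n%:R]%classic `*` setT) m f')//.
- rewrite ge0_integral_pushforward//; last 2 first.
    exact: (@measurable_fun_integral_finite_kernel _ _ _ _ _ f' Kk).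
    by move=> w _; apply: integral_ge0 => q _.
  rewrite preimage_setT [RHS]integral_mkcond; apply: eq_integral => w _ /=.
  rewrite patchE Kkw; under eq_integral do rewrite f'E.
  by case: ifPn => // _; rewrite integral0.
- exact: measurable_ray_rect.
- exact: ray_rect_setI.
- by move=> n; exists n%:R, setT.
- by rewrite bigcup_ray_rect setXTT.
- move=> D C mD [t [B [mB ->]]].
  have mKk : measurable_fun D (fun y => Kk y (`]-oo, t]%classic `*` B)).
    by apply: measurable_funTS; apply: measurable_kernel; exact: measurableX.
  rewrite [RHS]ge0_integral_pushforward//.
  transitivity
     (P x ((D : set (Omega R E)) `&` [set w | Tn k.+1 w <= t /\ X k.+1 w \in B])).
    congr (P x _); apply/seteqP; split => w; rewrite /= in_itv/= in_setE.
      by case.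
    by case.
  under eq_integral do rewrite /= Kkw (kernel_measure_ray HK)//.
  (* The law of the paths is prescribed for [t >= 0] only. For negative [t] the kernel has no mass
     on the ray, and the event lies in the null set of [Tn_gt0]. *)
  have [t0|t0] := leP 0 t; first exact: HP.2.
  rewrite integral0; apply: (subset_measure0 _ _ _ (Tn_gt0 x k)).
  + apply: measurableI; first exact: (F_measurable mD).
    rewrite (_ : [set w | _] = (fun w => w k.+1) @^-1` (`]-oo, t]%classic `*` B)).
      by rewrite -[X in measurable X]setTI; apply: mco => //; exact: measurableX.
    by apply/seteqP; split => w; rewrite /= in_itv/= in_setE.
  + rewrite (_ : [set w | _] =
        (fun w => w k.+1) @^-1` (`]-oo, 0]%classic `*` setT)).
      by rewrite -[X in measurable X]setTI; apply: mco => //; exact: measurableX.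
    by apply/seteqP; split => w; rewrite /= in_itv/= //; case.
  + by move=> w [_ [/= Tt _]]; exact: le_trans Tt (ltW t0).
Qed.
End OneStep.

(** * Paths and rewards *)

Section GoodPaths.
Context (R : realType) (d : measure_display) (E : measurableType d).
Implicit Types w : Omega R E.

(** On such a path the intervals [[S n w, S n.+1 w[] partition the nonnegative half-line, so [Xt] is
    the intended step process and its default value is never taken at a time [t >= 0]. *)
Definition regular_path w :=
  (forall n, 0 < Tn n.+1 w) /\ (forall M : R, exists n, M < S n w).

Lemma S_homo w : regular_path w -> {homo (fun n => S n w) : m n / (m <= n)%N >-> m <= n}.
Proof.
move=> [T0 _]; apply/nondecreasing_seqP => n.
by rewrite SES lerDl ltW.
Qed.

Lemma S_ge0 w n : regular_path w -> 0 <= S n w.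
Proof. by move=> gw; rewrite -(SE0 w); exact: S_homo. Qed.

Lemma XtE w n t : regular_path w -> S n w <= t < S n.+1 w -> Xt w t = X n w.
Proof.
move=> gw /andP[nt tn]; rewrite /Xt; apply: xget_subset1.
  by exists n; rewrite nt tn.
have uniq_idx m m' : S m w <= t < S m.+1 w -> S m' w <= t < S m'.+1 w -> m = m'.
  wlog mm' : m m' / (m < m')%N => [H|] h1 h2.
    have [| |//] := ltngtP m m' => mm'; first exact: H.
    by apply/esym; exact: H.
  case/andP : h1 => _ h1; case/andP: h2 => h2 _.
  by have := lt_le_trans h1 (le_trans (S_homo gw mm') h2); rewrite ltxx.
by move=> _ _ [m [hm ->]] [m' [hm' ->]]; rewrite (uniq_idx _ _ hm hm').
Qed.

Lemma S_locate w n t : regular_path w -> 0 <= t < S n w ->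
  exists2 j, (j < n)%N & S j w <= t < S j.+1 w.
Proof.
move=> gw; elim: n => [|n IH] /andP[t0 tn].
  by move: tn; rewrite SE0 ltNge t0.
have [tS|St] := ltP t (S n w).
  by have [|j jn jt] := IH _; rewrite ?t0//; exists j => //; exact: ltnW.
by exists n => //; rewrite St.
Qed.

Lemma lebesgue_step (a u v : R) : 0 <= u ->
  lebesgue_measure (`[0, a[%classic `&` `[u, v[%classic) =
    (clamp (v - u) (a - u))%:E.
Proof.
move=> u0; rewrite (_ : _ `&` _ = `[u, Num.min v a[%classic); last first.
  apply/seteqP; split => t /=; rewrite !in_itv/= lt_min.
    by move=> [/andP[_ ->] /andP[-> ->]].
  by move=> /andP[ut /andP[-> ->]]; rewrite ut (le_trans u0).
rewrite lebesgue_measure_itv/= lte_fin /clamp -addr_minl.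
case: ltP => h; rewrite -?EFinB; congr (_%:E).
  by rewrite max_r// subr_ge0 ltW.
by rewrite max_l// subr_le0.
Qed.

Lemma running_cost (c : E -> R) w n a : regular_path w ->
  (forall x, 0 <= c x) -> 0 <= a -> a <= S n w ->
  (\int[lebesgue_measure]_(t in `[0%R, a]) (c (Xt w t))%:E =
   \sum_(j < n) (c (X j w) * clamp (Tn j.+1 w) (a - S j w))%:E)%E.
Proof.
move=> gw c0 a0 aS.
pose h j (t : R) := ((c (X j w))%:E * (\1_(`[S j w, S j.+1 w[%classic) t)%:E)%E.
have hE t : `[0, a[%classic t -> (c (Xt w t))%:E = (\sum_(j < n) h j t)%E.
  rewrite /= in_itv/= => /andP[t0 ta].
  have [|j jn jt] := @S_locate w n t gw; first by rewrite t0 (lt_le_trans ta).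
  rewrite (XtE gw jt) (bigD1 (Ordinal jn))//= big1 ?adde0 => [|i ij].
    by rewrite /h indicE mem_set ?mule1//= in_itv.
  rewrite /h indicE memNset ?mule0//= in_itv/= => it.
  move/negP: ij; apply; apply/eqP/val_inj => /=.
  have [| |//] := ltngtP i j => ij.
    case/andP: it => _ it; case/andP: jt => jt _.
    by have := lt_le_trans it (le_trans (S_homo gw ij) jt); rewrite ltxx.
  case/andP: it => it _; case/andP: jt => _ jt.
  by have := lt_le_trans jt (le_trans (S_homo gw ij) it); rewrite ltxx.
have mh j : measurable_fun setT (h j).
  by apply: measurable_funeM; apply/measurable_EFinP; exact: measurable_indic.
have h0 j t : (0 <= h j t)%E by apply: mule_ge0; rewrite lee_fin.
(* The endpoint [a] is null and is dropped: it may equal [S n w], which the first [n] sojourn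
   intervals do not contain. *)
rewrite -integral_itv_bndo_bndc; last first.
  apply: (@eq_measurable_fun _ _ _ _ _ (fun t => \sum_(j < n) h j t)%E).
    by move=> t /set_mem ta; rewrite hE.
  by apply: emeasurable_sum => j; exact: measurable_funTS.
transitivity (\int[lebesgue_measure]_(t in `[0%R, a[) (\sum_(j < n) h j t))%E.
  by apply: eq_integral => t /set_mem ta; rewrite hE.
have mhD j : measurable_fun `[0, a[%classic (h j) by exact: measurable_funTS.
rewrite ge0_integral_sum//; last by move=> j; exact: mhD.
apply: eq_bigr => j _; rewrite ge0_integralZl_EFin//; last first.
  by apply/measurable_EFinP; exact: measurable_indic.
have -> : Tn j.+1 w = S j.+1 w - S j w by rewrite SES addrC addKr.
rewrite EFinM; congr (_ * _)%E; rewrite integral_indic// setIC.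
by apply: lebesgue_step; exact: S_ge0.
Qed.

End GoodPaths.

(** * Decomposition of the reward into stage rewards *)

Section Reward.
Context (R : realType) (d : measure_display) (E : measurableType d).
Variables (c g : E -> R) (s : R) (tau : Omega R E -> option nat).
Hypotheses (c0 : forall x, 0 <= c x) (g0 : forall x, 0 <= g x) (s0 : 0 <= s).
Implicit Types w : Omega R E.

Definition after j w : bool := if tau w is Some k then (j < k)%N else true.

Definition running j w : \bar R :=
  (c (X j w) * clamp (Tn j.+1 w) (s - S j w))%:E.

(** Zero from the horizon on, where [reward] charges no terminal cost. *)
Definition terminal j w : \bar R := if S j w < s then (g (X j w))%:E else 0%E.

Definition stage_reward j w : \bar R :=
  if tau w == Some j then terminal j w
  else if after j w then running j w else 0%E.

Lemma running_ge0 j w : (0 <= running j w)%E.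
Proof. by rewrite lee_fin mulr_ge0// clamp_ge0. Qed.

Lemma terminal_ge0 j w : (0 <= terminal j w)%E.
Proof. by rewrite /terminal; case: ifPn => // _; rewrite lee_fin. Qed.

Lemma stage_reward_ge0 j w : (0 <= stage_reward j w)%E.
Proof.
rewrite /stage_reward; case: ifPn => [_|_]; first exact: terminal_ge0.
by case: ifPn => // _; exact: running_ge0.
Qed.

Lemma nneseries_finite_support (f : (\bar R)^nat) N :
  (forall j, (N <= j)%N -> f j = 0%E) ->
  (\sum_(j <oo) f j = \sum_(j < N) f j)%E.
Proof.
move=> fN; apply: lim_near_cst => //; exists N => // n /= Nn.
rewrite (big_cat_nat _ Nn)//= big_mkord [X in (_ + X)%E]big_nat_cond [X in (_ + X)%E]big1 ?adde0//.
by move=> j /andP[/andP[Nj _] _]; exact: fN.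
Qed.

(** The [j]-th sojourn ends by [S k w], hence by [s], so cutting it at either time leaves it
    whole. *)
Lemma running_before_horizon j k w : regular_path w -> (j < k)%N -> S k w <= s ->
  running j w = (c (X j w) * clamp (Tn j.+1 w) (S k w - S j w))%:E.
Proof.
move=> gw jk Ss; rewrite /running /clamp; congr ((_ * Num.max _ _)%:E).
have Sj : S j w + Tn j.+1 w <= S k w by rewrite -SES; exact: S_homo.
by rewrite !min_l// lerBrDl// (le_trans Sj).
Qed.

(** Three cases: stopping at [k] before the horizon, stopping at [k] at or after it, never stopping.
    In each the series has finitely many nonzero terms and [running_cost] evaluates the integral. *)
Lemma reward_series w : regular_path w ->
  reward c g s tau w = (\sum_(j <oo) stage_reward j w)%E.
Proof.
move=> gw; rewrite /reward /Stau.
case tauw : (tau w) => [k|] /=.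
  rewrite (@nneseries_finite_support _ k.+1); last first.
    move=> j kj; rewrite /stage_reward /after tauw.
    rewrite (_ : Some k == Some j = false); first by rewrite ltnNge ltnW.
    by apply/eqP => -[kj']; move: kj; rewrite kj' ltnn.
  rewrite big_ord_recr/= {2}/stage_reward tauw eqxx.
  have -> : (\sum_(j < k) stage_reward j w = \sum_(j < k) running j w)%E.
    apply: eq_bigr => j _; rewrite /stage_reward /after tauw ltn_ord.
    rewrite (_ : Some k == Some (j : nat) = false)//.
    by apply/eqP => -[kj]; have := ltn_ord j; rewrite [X in (_ < X)%N -> _]kj ltnn.
  rewrite lte_fin /terminal; case: ifPn => [Ss|].
    rewrite (@running_cost _ _ _ c w k)// ?S_ge0//; congr (_ + _)%E.
      by apply: eq_bigr => j _; rewrite (@running_before_horizon _ k)// ltW.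
    congr ((g _)%:E); apply: XtE => //.
    by rewrite lexx/= SES ltrDl; case: gw.
  by rewrite -leNgt => sS; rewrite adde0 (@running_cost _ _ _ c w k).
(* Without explosion some [S n w] exceeds the horizon, so the reward is the running cost up to [s],
   and the stages from [n] on contribute nothing. *)
have [n sn] := gw.2 s.
have sSinf : (s%:E <= Sinf w)%E.
  rewrite /Sinf; have ndS : nondecreasing_seq (fun n => (S n w)%:E).
    by move=> i j ij; rewrite lee_fin; exact: S_homo.
  rewrite (cvg_lim _ (ereal_nondecreasing_cvgn ndS))//.
  apply: (@le_trans _ _ (S n w)%:E); first by rewrite lee_fin ltW.
  by apply: ereal_sup_ubound; exists n.
rewrite ltNge sSinf/= (@running_cost _ _ _ c w n)// ?ltW//.
rewrite (@nneseries_finite_support _ n).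
  by apply: eq_bigr => j _; rewrite /stage_reward /after tauw.
move=> j nj; rewrite /stage_reward /after tauw/= /running /clamp max_l ?mulr0//.
rewrite ge_min; apply/orP; right; rewrite subr_le0 ltW//.
by apply: lt_le_trans sn _; exact: S_homo.
Qed.

End Reward.

(** * Non-explosion: almost every path is regular *)

Section AlmostSure.
Context (R : realType) (d : measure_display) (E : measurableType d).
Variables (Q : R -> set E -> E -> R) (K : R.-pker E ~> (R * E)%type)
  (P : E -> probability (Omega R E) R).
Hypotheses (HQ : semi_Markov_kernel Q) (HR : regular_kernel Q)
  (HK : kernel_measure Q K) (HP : path_measures Q P).

Lemma measurable_S n : measurable_fun setT (@S R d E n).
Proof. exact: measurable_past (@measurable_past_S R d E n). Qed.

Lemma measurable_X n : measurable_fun setT (@X R d E n).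
Proof. exact: measurable_past (@measurable_past_X R d E n). Qed.

Lemma measurable_Tn n : measurable_fun setT (@Tn R d E n).
Proof. exact: measurable_past (@measurable_past_Tn R d E n). Qed.

(** For [t >= 0], [expR (- t)] is at most 1 if [t <= delta] and at most [expR (- delta)] otherwise;
    the regularity condition bounds the probability of the first case by [1 - eps]. *)
Lemma laplace_bound : exists2 rho : R, rho < 1 &
  forall x, (\int[K x]_p (expR (- p.1))%:E <= rho%:E)%E.
Proof.
have [delta [eps [d0 e0 Qd]]] := HR.
have ed1 : expR (- delta) < 1 :> R by rewrite expR_lt1 oppr_lt0.
(* This number is [1 - eps * (1 - expR (- delta))]. *)
exists (expR (- delta) + (1 - expR (- delta)) * (1 - eps)).
  have : 0 < eps * (1 - expR (- delta)) by rewrite mulr_gt0// subr_gt0.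
  lra.
move=> x; pose h (p : R * E) : \bar R := ((expR (- delta))%:E +
  (1 - expR (- delta))%:E * (\1_(`]-oo, delta]%classic `*` setT) p)%:E)%E.
have mB : measurable (`]-oo, delta]%classic `*` setT : set (R * E)).
  exact: measurableX.
have m1 : measurable_fun setT
    (fun p : R * E => (\1_(`]-oo, delta]%classic `*` setT) p)%:E : \bar R).
  by apply/measurable_EFinP; exact: measurable_indic.
have m2 : measurable_fun setT (fun p : R * E => ((1 - expR (- delta))%:E *
    (\1_(`]-oo, delta]%classic `*` setT) p)%:E)%E).
  exact: measurable_funeM.
have le10 : 0 <= 1 - expR (- delta) by rewrite subr_ge0 ltW.
have h20 (p : R * E) : (0 <= (1 - expR (- delta))%:E *
    (\1_(`]-oo, delta]%classic `*` setT) p)%:E)%E.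
  by apply: mule_ge0; rewrite lee_fin.
have mexp : measurable_fun setT (fun p : R * E => (expR (- p.1))%:E).
  apply/measurable_EFinP; apply: measurableT_comp => //.
  exact: measurableT_comp.
apply: (@le_trans _ _ (\int[K x]_p h p)%E).
  apply: ae_ge0_le_integral => //.
  - by move=> p _; rewrite adde_ge0// lee_fin expR_ge0.
  - by apply: emeasurable_funD.
  - apply: filterS (ae_kernel_ge0 HK x) => p p0 _.
    rewrite /h indicE; have [pd|pd] := leP p.1 delta.
      rewrite mem_set/=; last by rewrite in_itv/=.
      by rewrite mule1 -EFinD lee_fin addrC subrK expR_le1 oppr_le0.
    rewrite memNset ?mule0 ?adde0 ?lee_fin ?ler_expR ?lerN2 ?ltW//=.
    by rewrite in_itv/= => -[]; rewrite leNgt pd.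
rewrite /h ge0_integralD//.
rewrite integral_cst// ge0_integralZl_EFin// integral_indic// setIT.
have -> : K x (`]-oo, delta]%classic `*` setT) = (Q delta setT x)%:E.
  by have := kernel_measure_ray HK x delta measurableT; rewrite ltW.
have -> : K x setT = 1%E by exact: prob_kernel.
by rewrite mule1 -EFinM -EFinD lee_fin lerD2l ler_wpM2l.
Qed.

(** Induction on [n]: given the past, the factor contributed by the next sojourn integrates to at
    most [rho]. *)
Lemma laplace_decay : exists rho : R, [/\ 0 <= rho, rho < 1 &
  forall x n, (\int[P x]_w (expR (- S n w))%:E <= (rho ^+ n)%:E)%E].
Proof.
have [rho rho1 Hrho] := laplace_bound.
have rho0 : 0 <= rho.
  rewrite -lee_fin; apply: le_trans (Hrho point).
  by apply: integral_ge0 => p _; rewrite lee_fin expR_ge0.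
exists rho; split => // x; elim => [|n IH].
  under eq_integral do rewrite SE0 oppr0 expR0.
  rewrite integral_cst// mul1e expr0; exact: probability_le1.
pose f (z : Past R E n * (R * E)) : \bar R := (expR (- (S n z.1 + z.2.1)))%:E.
have f0 z : (0 <= f z)%E by rewrite lee_fin expR_ge0.
have mf : measurable_fun setT f.
  apply/measurable_EFinP; apply: measurableT_comp => //.
  apply: measurableT_comp => //; apply: measurable_funD.
    exact: measurableT_comp (@measurable_past_S R d E n) _.
  exact: measurableT_comp.
have := one_step HQ HK HP x (@measurableT _ (Past R E n)) f0 mf.
rewrite /f/= => fE.
under eq_integral do rewrite SES.
rewrite fE.
have mS : measurable_fun setT (fun w : Omega R E => (expR (- S n w))%:E : \bar R).
  apply/measurable_EFinP; apply: measurableT_comp => //.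
  by apply: measurableT_comp => //; exact: measurable_S.
apply: (@le_trans _ _ (\int[P x]_w (rho%:E * (expR (- S n w))%:E))%E); last first.
  rewrite ge0_integralZl_EFin//.
  by rewrite exprS EFinM lee_wpmul2l.
apply: ge0_le_integral => //.
- by move=> w _; apply: integral_ge0.
- apply: (@measurable_past _ _ _ n). exact: (measurable_one_step K f0 mf).
- exact: measurable_funeM.
move=> w _; under eq_integral do rewrite opprD expRD EFinM.
rewrite ge0_integralZl_EFin ?expR_ge0//; last first.
  apply/measurable_EFinP; apply: measurableT_comp => //.
  exact: measurableT_comp.
by rewrite muleC lee_wpmul2r// lee_fin expR_ge0.
Qed.

Lemma regular_path_ae x : \forall w \ae P x, regular_path w.
Proof.
have mSle n (M : R) : measurable [set w : Omega R E | S n w <= M].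
  rewrite -[X in measurable X]setTI.
  have := measurable_S n measurableT (measurable_itv `]-oo, M]%R).
  by congr measurable; apply/seteqP; split => w /=; rewrite in_itv.
have mTle n : measurable [set w : Omega R E | Tn n w <= 0].
  rewrite -[X in measurable X]setTI.
  have := measurable_Tn n measurableT (measurable_itv `]-oo, 0]%R).
  by congr measurable; apply/seteqP; split => w /=; rewrite in_itv.
have T_gt0 : \forall w \ae P x, forall n, 0 < Tn n.+1 w.
  apply: ae_foralln => n; exists [set w | Tn n.+1 w <= 0]; split => //.
    exact: Tn_gt0 HQ HP x n.
  by move=> w /= /negP; rewrite -leNgt.
have S_unbounded : \forall w \ae P x, forall m : nat, exists n, m%:R < S n w.
  apply: ae_foralln => m; exists (\bigcap_n [set w | S n w <= m%:R]); split.
  - exact: bigcapT_measurable.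
  - have [rho [rho0 rho1 Hrho]] := laplace_decay.
    set A := \bigcap_n _.
    have mA : measurable A by exact: bigcapT_measurable.
    (* Markov's inequality: on [A] every [S n w] is at most [m], so [expR (- S n w)] is at least
       [expR (- m)]. Letting [n] grow forces [P x A] to be zero. *)
    have Ple n : (P x A <= (expR m%:R * rho ^+ n)%:E)%E.
      have : ((expR (- m%:R))%:E * P x A <= (rho ^+ n)%:E)%E.
        apply: le_trans (Hrho x n).
        rewrite -[in leLHS](setIT A) -integral_indic// -ge0_integralZl_EFin//; last first.
          by apply/measurable_EFinP; exact: measurable_indic.
        apply: ge0_le_integral => //.
        + by apply: measurable_funeM; apply/measurable_EFinP; exact: measurable_indic.
        + apply/measurable_EFinP; apply: measurableT_comp => //.
          by apply: measurableT_comp => //; exact: measurable_S.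
        + move=> w _; rewrite indicE; case: (boolP (w \in A)) => wA.
            rewrite mule1 lee_fin ler_expR lerN2.
            by have /set_mem := wA; apply.
          by rewrite mule0 lee_fin expR_ge0.
      rewrite -(@lee_pmul2l _ (expR m%:R)%:E) ?fin_numE// ?lte_fin ?expR_gt0//.
      by rewrite muleA -!EFinM -expRD subrr expR0 mul1e.
    apply/eqP; rewrite eq_le measure_ge0 andbT.
    have cv : (expR m%:R * rho ^+ n)%:E @[n --> \oo] --> (expR m%:R * 0)%:E.
      apply: cvg_EFin; first by near=> n.
      by apply: cvgMr; apply: cvg_expr; rewrite ger0_norm.
    rewrite mulr0 in cv.
    apply: (@le_trans _ _ (limn (fun n => (expR m%:R * rho ^+ n)%:E))); last first.
      by rewrite (cvg_lim _ cv).
    apply: lime_ge; first exact: cvgP cv.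
    exact: nearW.
  - move=> w /= wn n _ /=; rewrite leNgt; apply/negP => Sn.
    by apply: wn; exists n.
apply: filterS2 T_gt0 S_unbounded => w T0 Sm; split => // M.
have [n Mn] := Sm (Num.Def.trunc M).+1; exists n.
exact: lt_trans (truncnS_gt M) Mn.
Unshelve. all: by end_near. Qed.
End AlmostSure.

(** * Stopping times and the value function *)

Section Verification.
Context (R : realType) (d : measure_display) (E : measurableType d).
Variables (Q : R -> set E -> E -> R) (K : R.-pker E ~> (R * E)%type)
  (P : E -> probability (Omega R E) R) (c g : E -> R) (s : R)
  (tau : Omega R E -> option nat).
Hypotheses (HQ : semi_Markov_kernel Q) (HK : kernel_measure Q K)
  (HP : path_measures Q P) (mc : measurable_fun setT c)
  (mg : measurable_fun setT g)
  (c0 : forall x, 0 <= c x) (g0 : forall x, 0 <= g x)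
  (Htau : stopping_time tau).

Local Notation r := (stage_reward c g s tau).

Lemma F_after j : F j [set w | after tau j w].
Proof.
rewrite (_ : [set w | _] =
    ~` (\bigcup_(i in `I_j.+1) [set w | tau w = Some i])).
  apply: (@measurableC _ (Past R E j)); apply: bigcup_measurable => i /= ij.
  by apply: (@F_le _ _ _ i j) => //; exact: Htau.
apply/seteqP; split => w /=; rewrite /after.
  case tauw : (tau w) => [k|] jk [i /= ij]; rewrite tauw// => -[ki].
  by move: ij; rewrite -ki ltnS leqNgt jk.
case tauw : (tau w) => [k|//] H; rewrite ltnNge; apply/negP => kj.
by apply: H; exists k.
Qed.

Lemma measurable_running j : measurable_fun setT (running c s j).
Proof.
apply/measurable_EFinP; apply: measurable_funM.
  exact: measurableT_comp (measurable_X j).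
apply: measurable_clamp; first exact: measurable_Tn.
by apply: measurable_funB => //; exact: measurable_S.
Qed.

Lemma measurable_terminal j : measurable_fun setT (@terminal _ _ E g s j).
Proof.
apply: measurable_fun_ifT => //.
  by apply: measurable_fun_ltr => //; exact: measurable_S.
by apply/measurable_EFinP; exact: measurableT_comp (measurable_X j).
Qed.

Lemma measurable_stage_reward j : measurable_fun setT (r j).
Proof.
apply: measurable_fun_ifT; last 2 first.
- exact: measurable_terminal.
- apply: measurable_fun_ifT => //; last exact: measurable_running.
  apply: (measurable_fun_bool true) => //; rewrite setTI.
  rewrite (_ : _ @^-1` _ = [set w | after tau j w]).
    exact: F_measurable (@F_after j).
  by apply/seteqP; split.
apply: (measurable_fun_bool true) => //; rewrite setTI.
rewrite (_ : _ @^-1` _ = [set w | tau w = Some j]).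
  exact: F_measurable (@Htau j).
by apply/seteqP; split => w /= /eqP.
Qed.

Lemma measurable_value (u : R -> E -> \bar R) k :
  measurable_fun setT (fun q : R * E => u q.1 q.2) ->
  measurable_fun setT (fun w : Omega R E => u (s - S k w) (X k w)).
Proof.
move=> mu; have mp : measurable_fun setT
    (fun w : Omega R E => (s - S k w, X k w)).
  apply: measurable_fun_pair; last exact: measurable_X.
  by apply: measurable_funB => //; exact: measurable_S.
exact: measurableT_comp mu mp.
Qed.

(** [one_step] for the integrand of [W], whose horizon [s - S k w] and state [X k w] are functions
    of the past. *)
Lemma step_W x k (A : set (Omega R E)) (u : R -> E -> \bar R) :
  F k A -> (forall t y, 0 <= u t y)%E ->
  measurable_fun setT (fun q : R * E => u q.1 q.2) ->
  (\int[P x]_(w in A) W K c u (s - S k w) (X k w) =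
   \int[P x]_(w in A) running c s k w +
   \int[P x]_(w in A) u (s - S k.+1 w)%R (X k.+1 w))%E.
Proof.
move=> FA u0 mu.
pose f (z : Past R E k * (R * E)) : \bar R :=
  ((c (X k z.1) * clamp z.2.1 (s - S k z.1))%:E +
    u ((s - S k z.1) - z.2.1)%R z.2.2)%E.
have f0 z : (0 <= f z)%E by exact: W_integrand_ge0.
have mf : measurable_fun setT f.
  have mfs : measurable_fun setT
      (fun z : Past R E k * (R * E) => s - S k z.1).
    apply: measurable_funB => //.
    exact: measurableT_comp (@measurable_past_S R d E k) _.
  have mfx : measurable_fun setT (fun z : Past R E k * (R * E) => X k z.1).
    exact: measurableT_comp (@measurable_past_X R d E k) _.
  exact: (measurable_W_integrand mc mu mfs mfx measurable_snd).
rewrite -(one_step HQ HK HP x FA f0 mf) /f/=.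
have mA := F_measurable FA.
rewrite -ge0_integralD//.
- by apply: eq_integral => w _; rewrite SES opprD addrA.
- by move=> w _; exact: running_ge0.
- by apply: measurable_funTS; exact: measurable_running.
- by apply: measurable_funTS; exact: measurable_value.
Qed.

(** The recursion peels off the first stage, as the inductions on [m] require while [k] moves
    forward. *)
Fixpoint tail_reward (m k : nat) (w : Omega R E) : \bar R :=
  if m is m'.+1 then (r k w + tail_reward m' k.+1 w)%E else 0%E.

Lemma tail_rewardE m k w :
  tail_reward m k w = (\sum_(k <= j < k + m) r j w)%E.
Proof.
elim: m k => [|m IH] k /=; first by rewrite addn0 big_geq.
by rewrite IH big_ltn ?addSnnS// -addSnnS ltnS leq_addr.
Qed.

Lemma tail_reward_ge0 m k w : (0 <= tail_reward m k w)%E.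
Proof. by rewrite tail_rewardE sume_ge0// => j _; exact: stage_reward_ge0. Qed.

Lemma measurable_tail_reward m k : measurable_fun setT (tail_reward m k).
Proof.
rewrite (_ : tail_reward m k = fun w => \sum_(k <= j < k + m) r j w)%E.
  by apply: emeasurable_sum => j; exact: measurable_stage_reward.
by apply/funext => w; rewrite tail_rewardE.
Qed.

(** Unlike [after k], this still allows stopping at [k] itself. *)
Definition alive k w : bool := if tau w is Some j then (k <= j)%N else true.

Lemma alive_split k (A : set (Omega R E)) : A `<=` [set w | alive k w] ->
  A = (A `&` [set w | tau w = Some k]) `|` (A `&` [set w | after tau k w]).
Proof.
move=> Ak; apply/seteqP; split => w; last by move=> [] [].
move=> Aw; have := Ak _ Aw; rewrite /= /alive /after.
case: (tau w) => [j|]; last by right.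
by rewrite leq_eqVlt => /orP[/eqP ->|kj]; [left|right].
Qed.

Lemma integral_alive_split x k (A : set (Omega R E)) (h : Omega R E -> \bar R) :
  F k A -> A `<=` [set w | alive k w] ->
  (forall w, 0 <= h w)%E -> measurable_fun setT h ->
  (\int[P x]_(w in A) h w =
   \int[P x]_(w in A `&` [set w | tau w = Some k]) h w +
   \int[P x]_(w in A `&` [set w | after tau k w]) h w)%E.
Proof.
move=> FA Ak h0 mh; rewrite {1}(alive_split Ak) ge0_integral_setU//.
- by apply: measurableI; [exact: F_measurable FA|exact: F_measurable (@Htau k)].
- by apply: measurableI; [exact: F_measurable FA|exact: F_measurable (@F_after k)].
- exact: measurable_funTS.
- apply/disj_setPLR => w [Aw tauw] [_]; rewrite /= /after tauw ltnn//.
Qed.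

Lemma F_setI k (A B : set (Omega R E)) : F k A -> F k B -> F k (A `&` B).
Proof. exact: (@measurableI _ (Past R E k)). Qed.

Lemma after_alive k (A : set (Omega R E)) :
  A `&` [set w | after tau k w] `<=` [set w | alive k.+1 w].
Proof. by move=> w []; rewrite /= /after /alive; case: (tau w). Qed.

Lemma tail_reward_stopped m k w : tau w = Some k ->
  tail_reward m.+1 k w = terminal g s k w.
Proof.
move=> tauw /=; rewrite {1}/stage_reward tauw eqxx tail_rewardE.
rewrite big_nat_cond big1 ?adde0// => j /andP[/andP[kj _] _].
rewrite /stage_reward /after tauw ltnNge ltnW//.
by rewrite (_ : Some k == Some j = false)//; apply/eqP => -[kj']; rewrite kj' ltnn in kj.
Qed.

Lemma stage_reward_running k w : after tau k w -> r k w = running c s k w.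
Proof.
rewrite /stage_reward => a; rewrite a; case: ifPn => // /eqP tauw.
by move: a; rewrite /after tauw ltnn.
Qed.

Lemma integral_tail_after x m k (A : set (Omega R E)) :
  F k A -> A `<=` [set w | after tau k w] ->
  (\int[P x]_(w in A) tail_reward m.+1 k w =
   \int[P x]_(w in A) running c s k w +
   \int[P x]_(w in A) tail_reward m k.+1 w)%E.
Proof.
move=> FA Aa; have mA := F_measurable FA.
rewrite -ge0_integralD//.
- by apply: eq_integral => w /set_mem Aw /=; rewrite stage_reward_running//; exact: Aa.
- by move=> w _; exact: running_ge0.
- by apply: measurable_funTS; exact: measurable_running.
- by move=> w _; exact: tail_reward_ge0.
- by apply: measurable_funTS; exact: measurable_tail_reward.
Qed.

(** The event [A] varies in the induction, since the hypothesis is applied to the smaller event of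
    running past [k]. On the stopped part [V] is at most [g], and zero past the horizon; on the
    other part [V m.+1] is at most [W (V m)], which [step_W] carries to stage [k.+1]. *)
Lemma Vseq_le_tail x m k (A : set (Omega R E)) :
  F k A -> A `<=` [set w | alive k w] ->
  (\int[P x]_(w in A) Vseq Q K c g m (s - S k w) (X k w) <=
   \int[P x]_(w in A) tail_reward m k w)%E.
Proof.
elim: m k A => [|m IH] k A FA Ak; first by [].
have V0 := Vseq_ge0 HK mc mg c0 g0.
have mV := measurable_Vseq HK mc mg c0 g0.
have F1 := F_setI FA (@Htau k); have F2 := F_setI FA (@F_after k).
have m1 := F_measurable F1; have m2 := F_measurable F2.
rewrite (integral_alive_split x FA Ak)//; last exact: measurable_value.
rewrite [leRHS](integral_alive_split x FA Ak); last 2 first.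
  exact: tail_reward_ge0.
  exact: measurable_tail_reward.
apply: leeD.
  apply: ge0_le_integral => //.
  - by apply: measurable_funTS; exact: measurable_value.
  - by apply: measurable_funTS; exact: measurable_tail_reward.
  - move=> w [_ tauw]; rewrite tail_reward_stopped// /terminal.
    case: ifPn => [_|]; first by rewrite (VseqS HK mc mg c0 g0) ge_min lexx orbT.
    by rewrite -leNgt => sS; rewrite (Vseq_eq0 HK mc mg c0 g0)// subr_le0.
apply: (@le_trans _ _ (\int[P x]_(w in A `&` [set w | after tau k w])
    W K c (Vseq Q K c g m) (s - S k w) (X k w))%E).
  apply: ge0_le_integral => //.
  - by apply: measurable_funTS; exact: measurable_value.
  - apply: measurable_funTS; apply: measurable_value; exact: measurable_W.
  - by move=> w _; rewrite (VseqS HK mc mg c0 g0) ge_min lexx.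
rewrite step_W// integral_tail_after//.
apply: leeD2l; apply: IH; last exact: after_alive.
exact: F_le F2.
Qed.

(** The two conditions on [tau] say that it stops only before the horizon where [g] is at most
    [Vlim], and continues before the horizon only where [Vlim] is below [g]. On the continuing part
    [Vlim] therefore equals [W Vlim]. *)
Lemma tail_le_Vlim x m k (A : set (Omega R E)) :
  (forall w j, tau w = Some j ->
     S j w < s /\ ((g (X j w))%:E <= Vlim Q K c g (s - S j w) (X j w))%E) ->
  (forall w j, after tau j w -> S j w < s ->
     (Vlim Q K c g (s - S j w) (X j w) < (g (X j w))%:E)%E) ->
  F k A -> A `<=` [set w | alive k w] ->
  (\int[P x]_(w in A) tail_reward m k w <=
   \int[P x]_(w in A) Vlim Q K c g (s - S k w) (X k w))%E.
Proof.
move=> Hstop Hcont; elim: m k A => [|m IH] k A FA Ak.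
  rewrite /= integral0; apply: integral_ge0 => w _; exact: Vlim_ge0 HK mc mg c0 g0 _ _.
have U0 := Vlim_ge0 HK mc mg c0 g0.
have mU := measurable_Vlim HK mc mg c0 g0.
have F1 := F_setI FA (@Htau k); have F2 := F_setI FA (@F_after k).
have m1 := F_measurable F1; have m2 := F_measurable F2.
rewrite (integral_alive_split x FA Ak); last 2 first.
  exact: tail_reward_ge0.
  exact: measurable_tail_reward.
rewrite [leRHS](integral_alive_split x FA Ak)//; last exact: measurable_value.
apply: leeD.
  apply: ge0_le_integral => //.
  - by move=> w _; exact: tail_reward_ge0.
  - by apply: measurable_funTS; exact: measurable_tail_reward.
  - by apply: measurable_funTS; exact: measurable_value.
  - move=> w [_ tauw]; rewrite tail_reward_stopped// /terminal.
    by have [-> ?] := Hstop _ _ tauw.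
rewrite (_ : (\int[P x]_(w in A `&` [set w | after tau k w]) Vlim _ _ _ _ _ _ =
    \int[P x]_(w in A `&` [set w | after tau k w])
      W K c (Vlim Q K c g) (s - S k w) (X k w))%E); last first.
  apply: eq_integral => w /set_mem [_ aw].
  (* Past the horizon both sides vanish; before it the minimum in the fixed-point equation is not
     attained by [g]. *)
  have [sS|Ss] := leP s (S k w).
    have sS0 : s - S k w <= 0 by rewrite subr_le0.
    rewrite (Vlim_eq0 HK mc mg c0 g0)// (W_eq0 HK mc c0 U0 mU)// => t y t0.
    exact: (Vlim_eq0 HK mc mg c0 g0).
  have := Hcont _ _ aw Ss.
  rewrite {1 2}(Vlim_fixpoint HK mc mg c0 g0) => Wg; rewrite min_l// ltW//.
  by move: Wg; rewrite gt_min ltxx orbF.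
rewrite step_W// integral_tail_after//.
apply: leeD2l; apply: IH; last exact: after_alive.
exact: F_le F2.
Qed.

End Verification.

Section LowerIntegral.
Import HBNNSimple.

(** [f] is not assumed measurable: for such an integrand [\int] is the supremum
    over the simple functions below it, which null sets do not affect either. *)
Lemma ge0_integral_ae_eq d (T : measurableType d) (R : realType)
    (mu : {measure set T -> \bar R}) (f h : T -> \bar R) :
  (forall x, 0 <= f x)%E -> (forall x, 0 <= h x)%E -> measurable_fun setT h ->
  (\forall x \ae mu, f x = h x) -> (\int[mu]_x f x = \int[mu]_x h x)%E.
Proof.
move=> f0 h0 mh fh; have [N [mN muN sN]] := fh.
have fhN x : ~ N x -> f x = h x.
  by move=> Nx; apply: contrapT => fhx; apply: Nx; exact: sN.
(* Setting [h] to zero on the null set puts it below [f] everywhere, so every simple function below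
   [h'] competes in the supremum defining the integral of [f]. *)
pose h' := h \_ (~` N).
have mh' : measurable_fun setT h'.
  by apply/(measurable_restrictT _ _).1; [exact: measurableC|exact: measurable_funTS].
have h'0 x : (0 <= h' x)%E by exact: erestrict_ge0.
apply/eqP; rewrite eq_le; apply/andP; split.
  rewrite [leLHS]ge0_integralTE//; apply: ge_ereal_sup => _ [k /= kf <-].
  rewrite -integralT_nnsfun; apply: ae_ge0_le_integral => //.
  - by move=> x _; rewrite lee_fin.
  - exact/measurable_EFinP.
  - by apply: filterS fh => x <- _; exact: kf.
have -> : (\int[mu]_x h x = \int[mu]_x h' x)%E.
  apply: ge0_ae_eq_integral => //; exists N; split => // x /= hh'.
  apply: contrapT => Nx; apply: hh' => _; rewrite /h' patchE mem_set//.
rewrite ge0_integralTE// [leRHS]ge0_integralTE//.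
apply: ge_ereal_sup => _ [k /= kh <-]; apply: ereal_sup_ubound.
exists k => //= x.
apply: le_trans (kh x) _; rewrite /h' patchE; case: ifPn => // /set_mem Nx.
by rewrite fhN.
Qed.

End LowerIntegral.

(** * Identification of the value function with the limit of value iteration *)

Section Value.
Context (R : realType) (d : measure_display) (E : measurableType d).
Variables (Q : R -> set E -> E -> R) (K : R.-pker E ~> (R * E)%type)
  (P : E -> probability (Omega R E) R) (c g : E -> R).
Hypotheses (HE : borel_space R E)
  (HQ : semi_Markov_kernel Q) (HR : regular_kernel Q) (HK : kernel_measure Q K)
  (HP : path_measures Q P) (mc : measurable_fun setT c)
  (mg : measurable_fun setT g)
  (c0 : forall x, 0 <= c x) (g0 : forall x, 0 <= g x).

Local Notation U := (Vlim Q K c g).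
Local Notation V := (Vseq Q K c g).

(** Singletons are measurable because [E] embeds measurably in the reals; this allows passing to the
    complement of the event of probability one. *)
Lemma X0_ae x : \forall w \ae P x, X 0 w = x.
Proof.
have [f [mf injf _ _]] := HE.
have mx : measurable [set x].
  rewrite (_ : [set x] = f @^-1` [set f x]).
    by rewrite -[X in measurable X]setTI; apply: mf => //; exact: measurable_set1.
  by apply/seteqP; split => y /= => [->//|/injf].
have mX : measurable [set w : Omega R E | X 0 w = x].
  by rewrite -[X in measurable X]setTI; exact: (@measurable_X R d E 0 measurableT _ mx).
exists (~` [set w | X 0 w = x]); split => //; first exact: measurableC.
by rewrite probability_setC// HP.1 subee.
Qed.

Lemma integral_X0 x (h : E -> \bar R) : (forall y, 0 <= h y)%E ->
  measurable_fun setT h -> (\int[P x]_w h (X 0 w) = h x)%E.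
Proof.
move=> h0 mh; transitivity (\int[P x]_w (cst (h x) w))%E.
  apply: ge0_ae_eq_integral => //.
  - exact: measurableT_comp mh (measurable_X 0).
  - by move=> w _; exact: h0.
  - by apply: filterS (X0_ae x) => w -> _.
have P1 : P x setT = 1%E by exact: probability_setT.
by rewrite integral_cst// -[RHS]mule1; congr (_ * _)%E.
Qed.

Lemma integral_value0 x s (u : R -> E -> \bar R) :
  (forall r y, 0 <= u r y)%E ->
  measurable_fun setT (fun q : R * E => u q.1 q.2) ->
  (\int[P x]_w u (s - S 0 w)%R (X 0 w) = u s x)%E.
Proof.
move=> u0 mu; under eq_integral do rewrite SE0 subr0.
apply: (@integral_X0 x (u s)) => //.
have mp : measurable_fun setT (fun y : E => (s, y)) by exact: measurable_fun_pair.
exact: (measurableT_comp mu mp).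
Qed.

Section Horizon.
Variable s : R.
Hypothesis s0 : 0 <= s.

(** Measurability is established for the series but not for [reward] itself, so the comparison goes
    through [ge0_integral_ae_eq]. *)
Lemma VtauE tau x : stopping_time tau ->
  Vtau P c g tau s x =
  (\int[P x]_w \sum_(j <oo) stage_reward c g s tau j w)%E.
Proof.
move=> Htau; apply: ge0_integral_ae_eq.
- move=> w; rewrite /reward; case: ifPn => _; last first.
    by apply: integral_ge0 => t _; rewrite lee_fin.
  by apply: adde_ge0; rewrite ?lee_fin//; apply: integral_ge0 => t _; rewrite lee_fin.
- by move=> w; apply: nneseries_ge0 => j _ _; exact: stage_reward_ge0.
- apply: ge0_emeasurable_sum => [j w _ _|j _]; first exact: stage_reward_ge0.
  exact: measurable_stage_reward.
- apply: filterS (regular_path_ae HQ HR HK HP x) => w gw.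
  exact: reward_series.
Qed.

Lemma integral_partial_reward tau x m : stopping_time tau ->
  (\int[P x]_w tail_reward c g s tau m 0 w =
   \sum_(0 <= j < m) \int[P x]_w stage_reward c g s tau j w)%E.
Proof.
move=> Htau; rewrite -ge0_integral_sum//.
- by apply: eq_integral => w _; rewrite tail_rewardE.
- by move=> j; exact: measurable_stage_reward.
- by move=> j w _; exact: stage_reward_ge0.
Qed.

Lemma Vtau_series tau x : stopping_time tau ->
  Vtau P c g tau s x =
  (\sum_(j <oo) \int[P x]_w stage_reward c g s tau j w)%E.
Proof.
move=> Htau; rewrite VtauE// integral_nneseries//.
- by move=> j; exact: measurable_stage_reward.
- by move=> j w _; exact: stage_reward_ge0.
Qed.

Lemma Vlim_le_Vtau tau x : stopping_time tau -> (U s x <= Vtau P c g tau s x)%E.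
Proof.
move=> Htau; apply: ge_ereal_sup => _ [m _ <-].
have V0 := Vseq_ge0 HK mc mg c0 g0 m.
have mV := measurable_Vseq HK mc mg c0 g0 m.
rewrite -(integral_value0 x s V0 mV) Vtau_series//.
apply: (@le_trans _ _ (\int[P x]_w tail_reward c g s tau m 0 w)%E).
  apply: (Vseq_le_tail s HQ HK HP mc mg c0 g0 Htau x m (A := setT)).
    exact: (@measurableT _ (Past R E 0)).
  by move=> w _; rewrite /= /alive; case: (tau w).
rewrite integral_partial_reward//; apply: nneseries_lim_ge => j _ _.
by apply: integral_ge0 => w _; exact: stage_reward_ge0.
Qed.

(** The strict inequality forbids stopping from the horizon on, where every later stage reward is
    zero anyway. *)
Definition stop_now n (w : Omega R E) : bool :=
  (S n w < s) && ((g (X n w))%:E <= U (s - S n w) (X n w))%E.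

Definition optimal_stop (w : Omega R E) : option nat :=
  if pselect (exists n, stop_now n w) is left h then Some (ex_minn h) else None.

Lemma optimal_stopP w n : optimal_stop w = Some n <->
  stop_now n w /\ forall j, (j < n)%N -> ~~ stop_now j w.
Proof.
rewrite /optimal_stop; case: pselect => [h|h]; last first.
  by split=> // -[sn _]; exfalso; apply: h; exists n.
case: ex_minnP => m sm mmin; split.
  move=> [<-]; split => // j jm; apply/negP => /mmin; rewrite leqNgt jm//.
move=> [sn nmin]; congr Some; apply/eqP; rewrite eqn_leq mmin//= leqNgt.
by apply/negP => /nmin; rewrite sm.
Qed.

Lemma after_optimal_stop w n : after optimal_stop n w -> ~~ stop_now n w.
Proof.
move=> a; apply/negP => sn; move: a; rewrite /after.
case taun : (optimal_stop w) => [k|].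
  by move=> nk; have [_ /(_ _ nk)] := (optimal_stopP w k).1 taun; rewrite sn.
move: taun; rewrite /optimal_stop; case: pselect => [//|h _].
by exfalso; apply: h; exists n.
Qed.

Lemma F_stop_now n : F n [set w | stop_now n w].
Proof.
have mS := @measurable_past_S R d E n.
have mX := @measurable_past_X R d E n.
rewrite (_ : [set w | _] = [set w | S n w < s] `&`
    [set w | (g (X n w))%:E <= U (s - S n w) (X n w)]%E); last first.
  by apply/seteqP; split => w /=; rewrite /stop_now => /andP.
apply: (@measurableI _ (Past R E n)).
  rewrite -[X in measurable X]setTI.
  have := mS measurableT _ (measurable_itv `]-oo, s[%R).
  by congr measurable; apply/seteqP; split => w /=; rewrite in_itv.
have mp : measurable_fun setT
    ((fun w => (s - S n w, X n w)) : Past R E n -> R * E).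
  by apply: measurable_fun_pair => //; exact: measurable_funB.
rewrite -[X in measurable X]setTI; apply: measurable_lee => //.
  by apply/measurable_EFinP; exact: measurableT_comp mX.
exact: (measurableT_comp (measurable_Vlim HK mc mg c0 g0) mp).
Qed.

Lemma stopping_time_optimal_stop : stopping_time optimal_stop.
Proof.
move=> n; rewrite (_ : [set w | _] = [set w | stop_now n w] `&`
    ~` \bigcup_(j in `I_n) [set w | stop_now j w]).
  apply: F_setI; first exact: F_stop_now.
  apply: (@measurableC _ (Past R E n)); apply: bigcup_measurable => j /= jn.
  by apply: (@F_le _ _ _ j n); [exact: ltnW|exact: F_stop_now].
apply/seteqP; split => w /=.
  by move=> /optimal_stopP[sn nmin]; split=> // -[j /= /nmin/negP].
move=> [sn H]; apply/optimal_stopP; split=> // j jn; apply/negP => sj.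
by apply: H; exists j.
Qed.

(** Each partial sum of expected stage rewards is already at most [U s x], hence so is their
    limit. *)
Lemma Vtau_optimal_le x : (Vtau P c g optimal_stop s x <= U s x)%E.
Proof.
have Htau := stopping_time_optimal_stop.
have U0 := Vlim_ge0 HK mc mg c0 g0; have mU := measurable_Vlim HK mc mg c0 g0.
rewrite Vtau_series//; apply: lime_le.
  apply: is_cvg_nneseries => j _ _.
  by apply: integral_ge0 => w _; exact: stage_reward_ge0.
apply: nearW => m; rewrite -integral_partial_reward//.
rewrite -[leRHS](integral_value0 x s U0 mU).
apply: (tail_le_Vlim HQ HK HP mc mg c0 g0 Htau x m (A := setT)).
- by move=> w j /optimal_stopP[/andP[? ?] _].
- move=> w j /after_optimal_stop; rewrite /stop_now negb_and -!leNgt.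
  by move=> /orP[sS|]; [rewrite ltNge sS|rewrite -ltNge].
- exact: (@measurableT _ (Past R E 0)).
- by move=> w _; rewrite /= /alive; case: optimal_stop.
Qed.

Lemma VstarE x : Vstar P c g s x = U s x.
Proof.
apply/eqP; rewrite eq_le; apply/andP; split.
  apply: le_trans (Vtau_optimal_le x); apply: ereal_inf_lbound.
  by exists optimal_stop => //; exact: stopping_time_optimal_stop.
by apply: le_ereal_inf_tmp => _ [tau Htau <-]; exact: Vlim_le_Vtau.
Qed.

End Horizon.

Lemma Vstar_fixpoint s x : 0 <= s ->
  Vstar P c g s x = Gop Q K c g (Vstar P c g) s x.
Proof.
move=> s0; rewrite VstarE// (Vlim_fixpoint HK mc mg c0 g0).
rewrite -(GopE g HK c0 s x (Vlim_ge0 HK mc mg c0 g0)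
  (Vlim_eq0 HK mc mg c0 g0) (measurable_Vlim HK mc mg c0 g0)).
(* The operator evaluates its argument only at horizons [s - p.1] with [p.1 <= s], the range in
   which [VstarE] applies. *)
rewrite /Gop; congr (mine (_ + _) _)%E.
apply: eq_integral => p /set_mem[/= + _]; rewrite in_itv/= => /andP[_ ps].
by rewrite VstarE// subr_ge0.
Qed.

End Value.

Theorem theorem4p3 (R : realType) (d : measure_display) (E : measurableType d)
    (Q : R -> set E -> E -> R)
    (mu : E -> {measure set (R * E)%type -> \bar R})
    (P : E -> probability (Omega R E) R)
    (c g : E -> R) (T : R) :
  borel_space R E ->
  semi_Markov_kernel Q ->
  regular_kernel Q ->
  kernel_measure Q mu ->
  path_measures Q P ->
  measurable_fun setT c -> measurable_fun setT g ->
  (forall x, 0 <= c x) -> (forall x, 0 <= g x) ->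
  0 <= T ->
  (forall s x, 0 <= s <= T ->
     (fun n => Vseq Q mu c g n s x) @ \oo --> Vstar P c g s x) /\
  (forall s x, 0 <= s <= T ->
     Vstar P c g s x = Gop Q mu c g (Vstar P c g) s x).
Proof.
move=> HE HQ HR Hmu HP mc mg c0 g0 _.
(* From here on [mu] is a bundled probability kernel. *)
have [K KE] := kernel_measure_pker HQ Hmu; subst mu.
split=> s x /andP[s0 _].
  by rewrite (VstarE HE HQ HR Hmu HP mc mg c0 g0 s0); exact: cvg_Vseq.
exact: Vstar_fixpoint.
Qed.
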